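(* Let $B\subset A$ be a non-degenerate inclusion of $C^*$-algebras and let $J\lhd A$ be a proper closed two-sided ideal. Regard $S(B/B\cap J)$ as the set $\{\varphi\in S(B): \varphi|_{B\cap J}=0\}$ and $P(B/B\cap J)$ as the set $\{\varphi\in P(B):\varphi|_{B\cap J}=0\}$. The following are equivalent: (i) $J$ is dominant relative to $B$; (ii) there exists $\Phi\subset S(B/B\cap J)$ such that all $A$-lifts of $\Phi$ are subordinated to $J$; (iii) there exists $\Phi\subset P(B/B\cap J)$ such that all $A$-lifts of $\Phi$ are subordinated to $J$; (iii') there exists $\Phi\subset P(B/B\cap J)$ such that all pure $A$-lifts of $\Phi$ are subordinated to $J$.
   Context: $S(A)$ and $P(A)$ denote the state space and the pure state space of a $C^*$-algebra $A$. The notation $L\lhd A$ means that $L$ is a closed two-sided ideal of $A$ with $L\neq A$. An inclusion of $C^*$-algebras $B\subset A$ is non-degenerate if $B$ contains an approximate unit for $A$; then restriction of states to $B$ maps $S(A)$ onto $S(B)$. For $\Phi\subset S(B)$, an $A$-lift of $\Phi$ is a set $\Sigma\subset S(A)$ such that $\psi\mapsto\psi|_B$ is a bijection of $\Sigma$ onto $\Phi$. If $\Phi\subset P(B)$, a pure $A$-lift of $\Phi$ is an $A$-lift $\Sigma$ with $\Sigma\subset P(A)$. For a positive linear map $\psi:A\to D$ between $C^*$-algebras, $K_\psi=\{a\in A:\psi(xay)=0\ \forall x,y\in A\}$. For a collection $\Psi=\{\psi_i\}_{i\in I}$ of positive linear maps defined on $A$, $K_\Psi=\bigcap_{i}K_{\psi_i}$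 (an intersection of ideals of $A$). The collection $\Psi$ is subordinated to $J$ if $K_\Psi\subset J$. The ideal $J$ is dominant relative to $B$ if every ideal $L\lhd A$ with $B\cap L\subset B\cap J$ satisfies $L\subset J$. *)

(* Defs.v *)
From HB Require Import structures.
From mathcomp Require Import all_boot all_order all_algebra.
From mathcomp Require Import complex.
From mathcomp Require Import all_classical all_reals all_analysis.
Set Implicit Arguments.
Unset Strict Implicit.
Unset Printing Implicit Defensive.
Import Order.TTheory GRing.Theory Num.Theory.
Import numFieldNormedType.Exports.
Local Open Scope classical_set_scope.
Local Open Scope complex_scope.
Local Open Scope ring_scope.

(* Complex C*-algebras, not assumed unital.  The norm of a normed module over
   R[i] takes its values in R[i]; since 0 <= z in R[i] forces z to be real, it
   is a real-valued norm. *)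
HB.mixin Record isCStarAlgebra (R : realType) A
    of CompleteNormedModule R[i] A := {
  cmul : A -> A -> A ;
  cstar : A -> A ;
  cmulA : associative cmul ;
  cmulDl : left_distributive cmul +%R ;
  cmulDr : right_distributive cmul +%R ;
  cmulZl : forall (c : R[i]) (x y : A), cmul (c *: x) y = c *: cmul x y ;
  cmulZr : forall (c : R[i]) (x y : A), cmul x (c *: y) = c *: cmul x y ;
  cstarK : involutive cstar ;
  cstarD : {morph cstar : x y / x + y} ;
  cstarZ : forall (c : R[i]) (x : A), cstar (c *: x) = c^* *: cstar x ;
  cstarM : forall x y : A, cstar (cmul x y) = cmul (cstar y) (cstar x) ;
  cnormM : forall x y : A, `|cmul x y| <= `|x| * `|y| ;
  cnormCstar : forall x : A, `|cmul (cstar x) x| = `|x| ^+ 2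
}.

#[short(type="cstarAlgType")]
HB.structure Definition CStarAlgebra (R : realType) :=
  { A of isCStarAlgebra R A & CompleteNormedModule R[i] A }.

Declare Scope cstar_scope.
Delimit Scope cstar_scope with C_star.
Notation "x ** y" := (cmul x y)
  (at level 40, left associativity) : cstar_scope.
Local Open Scope cstar_scope.

Section Notions.
Context {R : realType}.
Local Notation C := R[i].

Definition positive_elt {A : cstarAlgType R} (a : A) : Prop :=
  exists b : A, a = cstar b ** b.

(* A C*-subalgebra B of A is given by its inclusion map, i.e. by a
   norm-preserving *-homomorphism; the trace B `&` L of L : set A is then [iota @^-1` L],
   and the restriction to B of psi : A -> C is [psi \o iota]. *)
Definition cstar_inclusion {B A : cstarAlgType R} (iota : B -> A) : Prop :=
  [/\ linear iota,
      {morph iota : x y / x ** y},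
      {morph iota : x / cstar x} &
      {mono iota : x / `|x|}].

(* Approximate units are nets of positive contractions.  Convergence along a
   net is convergence along the filter F generated by the tails of its index. *)
Definition nondegenerate_inclusion {B A : cstarAlgType R} (iota : B -> A) : Prop :=
  exists (I : Type) (F : set_system I) (e : I -> B),
    [/\ ProperFilter F,
        (forall i, positive_elt (e i) /\ `|e i| <= 1) &
        (forall a : A, (iota (e i) ** a @[i --> F] --> a) /\
                       (a ** iota (e i) @[i --> F] --> a))].

Definition positive_functional {A : cstarAlgType R} (phi : A -> C) : Prop :=
  scalar phi /\ (forall a : A, 0 <= phi (cstar a ** a)).

(* If the set below is unbounded then its [sup] is 0 by convention, so the
   value 1 is taken only by bounded functionals. *)
Definition functional_norm {A : cstarAlgType R} (phi : A -> C) : R :=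
  sup [set complex.Re `|phi a| | a in [set a : A | `|a| <= 1]].

Definition states (A : cstarAlgType R) : set (A -> C) :=
  [set phi | positive_functional phi /\ functional_norm phi = 1].
Arguments states : clear implicits.

(* The extreme points of the state space. *)
Definition pure_states (A : cstarAlgType R) : set (A -> C) :=
  [set phi | states A phi /\
     forall (phi1 phi2 : A -> C) (t : R),
       states A phi1 -> states A phi2 -> 0 < t < 1 ->
       (forall a, phi a = t%:C * phi1 a + (1 - t)%:C * phi2 a) ->
       phi1 = phi /\ phi2 = phi].
Arguments pure_states : clear implicits.

Definition closed_ideal {A : cstarAlgType R} (L : set A) : Prop :=
  [/\ closed L,
      L 0,
      (forall (c : C) (x y : A), L x -> L y -> L (c *: x + y)) &
      (forall a x : A, L x -> L (a ** x) /\ L (x ** a))].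

Definition proper_closed_ideal {A : cstarAlgType R} (L : set A) : Prop :=
  closed_ideal L /\ L <> setT.

Definition dominant_ideal {B A : cstarAlgType R} (iota : B -> A) (J : set A) : Prop :=
  forall L : set A, proper_closed_ideal L ->
    iota @^-1` L `<=` iota @^-1` J -> L `<=` J.

Definition vanishing_on {A : cstarAlgType R} (L : set A) : set (A -> C) :=
  [set phi | forall a, L a -> phi a = 0].

Definition is_lift {B A : cstarAlgType R} (iota : B -> A)
    (Phi : set (B -> C)) (Sigma : set (A -> C)) : Prop :=
  Sigma `<=` states A /\ set_bij Sigma Phi (fun psi => psi \o iota).

Definition is_pure_lift {B A : cstarAlgType R} (iota : B -> A)
    (Phi : set (B -> C)) (Sigma : set (A -> C)) : Prop :=
  is_lift iota Phi Sigma /\ Sigma `<=` pure_states A.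

Definition map_kernel {A : cstarAlgType R} {D : zmodType} (psi : A -> D) : set A :=
  [set a | forall x y : A, psi (x ** a ** y) = 0].

Definition family_kernel {A : cstarAlgType R} (Psi : set (A -> C)) : set A :=
  \bigcap_(psi in Psi) map_kernel psi.

Definition subordinated {A : cstarAlgType R} (Psi : set (A -> C)) (J : set A) :
    Prop :=
  family_kernel Psi `<=` J.

End Notions.

Arguments states {R} A.
Arguments pure_states {R} A.

(* Main.v *)
(* For (ii) => (i) and (iii') => (i) one needs: a state phi of B vanishing on the
   trace of an ideal L extends to a state of A vanishing on L, pure if phi is.
   Lifts chosen this way kill L, whence L is contained in J.  For (i) => (iii),
   take all pure states vanishing on the trace of J: they separate the points of
   B outside J, so the kernel of any lift has its trace in J.

   Both facts come from one real sublinear functional on the unitization of A,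
     umaj L x = inf {t | t - Re x - l >= 0 for some self-adjoint l in L},
   the top of the numerical range of x modulo L, by an extreme-point form of the
   Hahn-Banach theorem.  Positivity means |t - x| <= t for some t; with square
   roots obtained from the fixed point z = (w + z^2) / 2, this avoids spectra and
   the functional calculus, and it makes quotients by L unnecessary: the iterates
   for w and w' agree modulo L whenever w and w' do. *)
Require Import Defs.
From HB Require Import structures.
From mathcomp Require Import all_boot all_order all_algebra.
From mathcomp Require Import complex.
From mathcomp Require Import all_classical all_reals all_analysis.
From mathcomp Require Import ring lra.
From Stdlib Require Ncring Ncring_tac.
Set Implicit Arguments.
Unset Strict Implicit.
Unset Printing Implicit Defensive.
Import Order.TTheory GRing.Theory Num.Theory.
Import numFieldNormedType.Exports.
Local Open Scope classical_set_scope.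
Local Open Scope complex_scope.
Local Open Scope ring_scope.

Local Notation re := complex.Re.
Local Notation im := complex.Im.

(** * Unital C*-algebras with a real-valued norm *)

(** Classically a state of [B] killing the trace of [L] is carried into the quotient of [A] along an
    isometric embedding of quotients. That isometry is replaced by one inequality: [re phi] lies
    below [umaj L] on [B]. If [t - Re x] is positive modulo [L], it differs from its absolute value
    by an element of [L]; that absolute value is formed inside the unitization of [B], so the
    difference lies in the trace, where [phi] vanishes. Positivity, contractivity and vanishing on
    [L] are all encoded in lying below [umaj L], but two properties are not. The first is norm 1: as
    [A] need not be unital, the zero functional on [A] also gives something below [umaj L], so the
    norm is recovered from [phi] when extending and from maximality at a point when separating. The
    second is purity: Hahn-Banach gives extremality only among functionals with prescribed values,
    and this becomes extremality among states because every decomposition of the state inherits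
    those values. *)

#[local] Instance ncring_ops (U : pzRingType) :
  @Ncring.Ring_ops U 0 1 +%R *%R (fun x y => x - y) -%R (@eq U) := {}.
#[local] Instance ncring_ring (U : pzRingType) :
  Ncring.Ring (Ro := ncring_ops U).
Proof.
split; compute -[GRing.add GRing.mul GRing.opp GRing.zero GRing.one
  Algebra.zero Algebra.add Algebra.opp].
exact RelationClasses.eq_equivalence.
1-4: by repeat move=> ? ? ->.
exact (@add0r U).
exact (@addrC U).
exact (@addrA U).
exact (@mul1r U).
exact (@mulr1 U).
exact (@mulrA U).
exact (@mulrDl U).
by move=> x y z; exact (@mulrDr U z x y).
by [].
exact (@subrr U).
Qed.
Ltac ncring := rewrite ?expr2; Ncring_tac.non_commutative_ring.


Definition modc {R : realType} (z : R[i]) : R := complex.Re `|z|.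

(* Completeness is only asked along the sequences that the square root
   iteration produces: increments dominated by those of a bounded sequence. *)
HB.mixin Record isUnitalCStar (R : realType) U of GRing.Algebra R[i] U := {
  ust : U -> U ;
  nm : U -> R ;
  ustK : involutive ust ;
  ustD : {morph ust : x y / x + y} ;
  ustM : forall x y : U, ust (x * y) = ust y * ust x ;
  ustZ : forall (c : R[i]) (x : U), ust (c *: x) = conjc c *: ust x ;
  nmD : forall x y : U, nm (x + y) <= nm x + nm y ;
  nmZ : forall (c : R[i]) (x : U), nm (c *: x) = modc c * nm x ;
  nmM : forall x y : U, nm (x * y) <= nm x * nm y ;
  nm_ust_mul : forall x : U, nm (ust x * x) = nm x ^+ 2 ;
  nm_eq0 : forall x : U, nm x = 0 -> x = 0 ;
  nm_complete : forall (u : nat -> U) (r : nat -> R),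
    (forall n, nm (u n.+1 - u n) <= r n.+1 - r n) -> (forall n, r n <= 1) ->
    exists z, forall eps, 0 < eps ->
      exists n0, forall n, (n0 <= n)%N -> nm (u n - z) <= eps
}.

#[short(type="unitalCStarType")]
HB.structure Definition UnitalCStar (R : realType) :=
  { U of isUnitalCStar R U & GRing.Algebra R[i] U }.

Section ModC.
Context {R : realType}.
Implicit Types (z w : R[i]) (t : R).

Lemma modcE z : (modc z)%:C = `|z|.
Proof. by rewrite /modc RRe_real. Qed.

Lemma modcR t : modc t%:C = `|t|.
Proof.
apply: complexI; rewrite modcE normc_def /=.
by rewrite expr0n /= addr0 sqrtr_sqr.
Qed.

Lemma modc_ge0 z : 0 <= modc z.
Proof. by rewrite -ler0c modcE. Qed.

Lemma modcM z w : modc (z * w) = modc z * modc w.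
Proof. by apply: complexI; rewrite rmorphM /= !modcE normrM. Qed.

Lemma modcD z w : modc (z + w) <= modc z + modc w.
Proof. by rewrite -lecR rmorphD /= !modcE ler_normD. Qed.

Lemma modcJ z : modc (conjc z) = modc z.
Proof. by apply: complexI; rewrite !modcE normcJ. Qed.

Lemma modcN z : modc (- z) = modc z.
Proof. by rewrite /modc normrN. Qed.

Lemma modc_sqr z : modc z ^+ 2 = re z ^+ 2 + im z ^+ 2.
Proof. by apply: complexI; rewrite rmorphXn /= modcE -add_Re2_Im2. Qed.

Lemma Re_le_modc z : re z <= modc z.
Proof. by rewrite (le_trans (ler_norm _))// -lecR modcE normc_ge_Re. Qed.

Lemma modc0_eq0 z : modc z = 0 -> z = 0.
Proof. by move=> h; apply/eqP; rewrite -normr_eq0 -modcE h. Qed.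

End ModC.

Section UnitalTheory.
Context {R : realType} {U : unitalCStarType R}.
Implicit Types (x y z w h : U) (t s r : R).
Local Notation N := (@nm R U).

Definition rs t : U := (t%:C)%:A.

Lemma rsZ t x : rs t * x = t%:C *: x.
Proof. by rewrite /rs -scalerAl mul1r. Qed.
Lemma rsC t x : rs t * x = x * rs t.
Proof. by rewrite rsZ /rs -scalerAr mulr1. Qed.
Lemma rsD t s : rs (t + s) = rs t + rs s.
Proof. by rewrite /rs rmorphD scalerDl. Qed.
Lemma rsM t s : rs (t * s) = rs t * rs s.
Proof. by rewrite rsZ /rs rmorphM scalerA. Qed.
Lemma rsN t : rs (- t) = - rs t.
Proof. by rewrite /rs rmorphN scaleNr. Qed.
Lemma rs1 : rs 1 = 1. Proof. by rewrite /rs scale1r. Qed.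
Lemma rs0 : rs 0 = 0. Proof. by rewrite /rs scale0r. Qed.

Lemma ust1 : ust (1 : U) = 1.
Proof. by rewrite -[LHS]mulr1 -[X in _ * X]ustK -ustM mulr1 ustK. Qed.
Lemma ust_rs t : ust (rs t) = rs t.
Proof. by rewrite /rs ustZ conjc_real ust1. Qed.
Lemma ust0 : ust (0 : U) = 0.
Proof. by rewrite -rs0 ust_rs. Qed.
Lemma ustN x : ust (- x) = - ust x.
Proof. by apply: (addrI (ust x)); rewrite -ustD !subrr ust0. Qed.
Lemma ustB x y : ust (x - y) = ust x - ust y.
Proof. by rewrite ustD ustN. Qed.

Lemma nm_rs t x : N (rs t * x) = `|t| * N x.
Proof. by rewrite rsZ nmZ modcR. Qed.
Lemma nm0 : N 0 = 0.
Proof. by rewrite -[X in N X](scale0r 0) nmZ modcR normr0 mul0r. Qed.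
Lemma nmN x : N (- x) = N x.
Proof.
by rewrite -scaleN1r nmZ -(rmorph1 (real_complex R)) -rmorphN modcR normrN normr1 mul1r.
Qed.
Lemma nmBC x y : N (x - y) = N (y - x).
Proof. by rewrite -nmN opprB. Qed.
Lemma nm_ge0 x : 0 <= N x.
Proof. by have := nmD x (- x); rewrite subrr nm0 nmN; lra. Qed.
Lemma nmB x y : N (x - y) <= N x + N y.
Proof. by rewrite -[N y]nmN nmD. Qed.
Lemma nm1_le1 : N 1 <= 1.
Proof.
have := nm_ust_mul (1 : U); rewrite ust1 mulr1.
by have := nm_ge0 1; nra.
Qed.
Lemma nm_scal t : N (rs t) <= `|t|.
Proof. by rewrite -[rs t]mulr1 nm_rs ler_piMr ?nm1_le1. Qed.

Lemma nm_ust x : N (ust x) = N x.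
Proof.
have le y : N y <= N (ust y).
  have := nmM (ust y) y; rewrite nm_ust_mul.
  by have := nm_ge0 y; have := nm_ge0 (ust y); nra.
by apply/eqP; rewrite eq_le le -{2}[x]ustK le.
Qed.

Lemma nm_sa_sqr h : ust h = h -> N (h * h) = N h ^+ 2.
Proof. by move=> {1}<-; rewrite nm_ust_mul. Qed.
Lemma sqr_eq0_sa h : ust h = h -> h * h = 0 -> h = 0.
Proof.
move=> hs h0; apply: nm_eq0; have := nm_sa_sqr hs; rewrite h0 nm0.
by move/esym/eqP; rewrite sqrf_eq0 => /eqP.
Qed.
Lemma ust_mul_eq0 x : ust x * x = 0 -> x = 0.
Proof.
move=> h0; apply: nm_eq0; have := nm_ust_mul x; rewrite h0 nm0.
by move/esym/eqP; rewrite sqrf_eq0 => /eqP.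
Qed.

Definition cvN (u : nat -> U) z := forall eps, 0 < eps ->
  exists n0, forall n, (n0 <= n)%N -> N (u n - z) <= eps.

Lemma cvN_uniq u z z' : cvN u z -> cvN u z' -> z = z'.
Proof.
move=> uz uz'; apply/eqP; rewrite -subr_eq0; apply/eqP/nm_eq0/eqP.
rewrite eq_le nm_ge0 andbT; apply/ler_addgt0Pl => e e0; rewrite addr0.
have e20 : 0 < e / 2 by lra.
have [n0 h0] := uz _ e20; have [n1 h1] := uz' _ e20.
have /h0 a0 := leq_maxl n0 n1; have /h1 a1 := leq_maxr n0 n1.
set n := maxn n0 n1 in a0 a1.
have -> : z - z' = (z - u n) - (z' - u n) by ncring.
by apply: (le_trans (nmB _ _)); rewrite nmBC (nmBC z'); lra.
Qed.

Lemma cvN_lip (u v : nat -> U) z z' (k : R) :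
  (forall n, N (v n - z') <= k * N (u n - z)) -> cvN u z -> cvN v z'.
Proof.
move=> h uz e e0; have k0 : 0 < `|k| + 1 by have := normr_ge0 k; lra.
have /uz[n0 hn0] : 0 < e / (`|k| + 1) by rewrite divr_gt0.
exists n0 => n /hn0; rewrite ler_pdivlMr// => hn; apply: (le_trans (h n)).
apply: le_trans hn; rewrite mulrC; apply: ler_wpM2l; rewrite ?nm_ge0//.
by have := ler_norm k; lra.
Qed.

Lemma cvN_sum (u v w : nat -> U) a b c :
  (forall n, N (w n - c) <= N (u n - a) + N (v n - b)) ->
  cvN u a -> cvN v b -> cvN w c.
Proof.
move=> h ua vb e e0; have e20 : 0 < e / 2 by lra.
have [n0 h0] := ua _ e20; have [n1 h1] := vb _ e20.
exists (maxn n0 n1) => n; rewrite geq_max => /andP[/h0 a0 /h1 a1].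
by apply: (le_trans (h n)); lra.
Qed.

Lemma cvND u v a b : cvN u a -> cvN v b -> cvN (fun n => u n + v n) (a + b).
Proof.
apply: cvN_sum => n; apply: le_trans (nmD _ _).
by have -> : u n + v n - (a + b) = (u n - a) + (v n - b) by ncring.
Qed.

Lemma cvNMl c u a : cvN u a -> cvN (fun n => c * u n) (c * a).
Proof. by apply: (cvN_lip (k := N c)) => n; rewrite -mulrBr nmM. Qed.
Lemma cvNMr c u a : cvN u a -> cvN (fun n => u n * c) (a * c).
Proof. by apply: (cvN_lip (k := N c)) => n; rewrite -mulrBl mulrC nmM. Qed.
Lemma cvN_cst c : cvN (fun=> c) c.
Proof. by move=> e e0; exists 0%N => n _; rewrite subrr nm0 ltW. Qed.
Lemma cvN_ust u a : cvN u a -> cvN (fun n => ust (u n)) (ust a).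
Proof. by apply: (cvN_lip (k := 1)) => n; rewrite -ustB nm_ust mul1r. Qed.
Lemma cvNS u a : cvN u a -> cvN (fun n => u n.+1) a.
Proof.
by move=> ua e /ua[n0 h]; exists n0 => n hn; apply: h; rewrite ltnW.
Qed.
Lemma cvN_sqr u a (k : R) : (forall n, N (u n) <= k) ->
  cvN u a -> cvN (fun n => u n * u n) (a * a).
Proof.
move=> uk; apply: (cvN_lip (k := k + N a)) => n.
have -> : u n * u n - a * a = u n * (u n - a) + (u n - a) * a by ncring.
apply: (le_trans (nmD _ _)); have := nmM (u n) (u n - a).
have := nmM (u n - a) a; have := nm_ge0 (u n - a); have := uk n; nra.
Qed.
Lemma cvN_bnd u a (k : R) : (forall n, N (u n) <= k) -> cvN u a -> N a <= k.
Proof.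
move=> uk ua; apply/ler_addgt0Pl => e /ua[n0 /(_ _ (leqnn _)) h].
have -> : a = u n0 - (u n0 - a) by ncring.
by apply: (le_trans (nmB _ _)); have := uk n0; lra.
Qed.

(* The fixed point of [z = (w + z^2) / 2], so that [1 - z] is a square root of
   [1 - w]; the increments are dominated by those of the scalar case [w = 1]. *)
Fixpoint sqrt_iter w n : U :=
  if n is m.+1 then rs 2^-1 * (w + sqrt_iter w m * sqrt_iter w m) else 0.
Fixpoint sqrt_iter1 n : R := if n is m.+1 then 2^-1 * (1 + sqrt_iter1 m ^+ 2) else 0.
(** The limit is only used for [N w <= 1], where the iteration converges and the default 0 is not
    taken. *)
Definition sqrt_lim w : U := xget 0 [set z | cvN (sqrt_iter w) z].

Lemma sqrt_iter1_bnd n : 0 <= sqrt_iter1 n <= 1.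
Proof. elim: n => [|n /andP[a b]] /=; nra. Qed.

Lemma sqrt_iter_bnd w n : N w <= 1 -> N (sqrt_iter w n) <= sqrt_iter1 n.
Proof.
move=> w1; elim: n => [|n IH] /=; first by rewrite nm0.
rewrite nm_rs ger0_norm; last by lra.
apply: ler_wpM2l; first lra.
apply: (le_trans (nmD _ _)); apply: lerD => //; apply: (le_trans (nmM _ _)).
by rewrite expr2; apply: ler_pM; rewrite ?nm_ge0.
Qed.

Lemma sqrt_iter_le1 w n : N w <= 1 -> N (sqrt_iter w n) <= 1.
Proof. by move=> /sqrt_iter_bnd/le_trans; apply; have /andP[] := sqrt_iter1_bnd n. Qed.

Lemma sqrt_iter_inc w n : N w <= 1 ->
  N (sqrt_iter w n.+1 - sqrt_iter w n) <= sqrt_iter1 n.+1 - sqrt_iter1 n.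
Proof.
move=> w1; elim: n => [|n IH].
  rewrite /= !(mulr0, addr0, subr0, expr0n) nm_rs ger0_norm; last by lra.
  by rewrite /= ?mulr1 ?addr0; lra.
rewrite [sqrt_iter w n.+2]/= [sqrt_iter1 n.+2]/=.
(* The factorization [p^2 - q^2 = (p - q) p + q (p - q)] does not need [p] and [q] to commute. The
   scalar sequence satisfies the same identity, so its increments dominate again. *)
have -> : rs 2^-1 * (w + sqrt_iter w n.+1 * sqrt_iter w n.+1) - sqrt_iter w n.+1 =
  rs 2^-1 * ((sqrt_iter w n.+1 - sqrt_iter w n) * sqrt_iter w n.+1 +
             sqrt_iter w n * (sqrt_iter w n.+1 - sqrt_iter w n)).
  have E : sqrt_iter w n.+1 = rs 2^-1 * (w + sqrt_iter w n * sqrt_iter w n) by [].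
  rewrite [X in _ - X = _]E; ncring.
rewrite nm_rs ger0_norm; last by lra.
apply: (le_trans (ler_wpM2l _ (nmD _ _))); first lra.
have := nmM (sqrt_iter w n.+1 - sqrt_iter w n) (sqrt_iter w n.+1).
have := nmM (sqrt_iter w n) (sqrt_iter w n.+1 - sqrt_iter w n).
have := sqrt_iter_bnd n w1; have := sqrt_iter_bnd n.+1 w1.
have := sqrt_iter1_bnd n; have := sqrt_iter1_bnd n.+1.
have : sqrt_iter1 n.+1 = 2^-1 * (1 + sqrt_iter1 n ^+ 2) by [].
move: IH (nm_ge0 (sqrt_iter w n)) (nm_ge0 (sqrt_iter w n.+1))
  (nm_ge0 (sqrt_iter w n.+1 - sqrt_iter w n)).
move: (N _) (N _) (N _) (N _) (N _) (sqrt_iter1 n) (sqrt_iter1 n.+1) => d a b p q r1 r2.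
move=> dr b0 a0 d0 rE /andP[r20 r21] /andP[r10 r11] bh ah qh ph.
have := rE; nra.
Qed.

End UnitalTheory.

(** * Square roots and positivity *)

Section Roots.
Context {R : realType} {U : unitalCStarType R}.
Implicit Types (x y z w h c : U) (t s r : R).
Local Notation N := (@nm R U).
Local Notation rs := (@rs R U).

Lemma sqrt_limP w : N w <= 1 -> cvN (sqrt_iter w) (sqrt_lim w).
Proof.
move=> w1; rewrite /sqrt_lim; case: xgetP => [z -> //|/=].
have [z hz] := @nm_complete R U (sqrt_iter w) (@sqrt_iter1 R) (fun n => sqrt_iter_inc n w1)
  (fun n => proj2 (andP (sqrt_iter1_bnd n))).
by move=> /(_ z); case.
Qed.

Lemma sqrt_lim_eqn w : N w <= 1 -> rs 2 * sqrt_lim w = w + sqrt_lim w * sqrt_lim w.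
Proof.
move=> w1; have cz := sqrt_limP w1.
have : cvN (fun n => rs 2 * sqrt_iter w n.+1) (rs 2 * sqrt_lim w).
  exact: cvNMl (cvNS cz).
have : cvN (fun n => w + sqrt_iter w n * sqrt_iter w n) (w + sqrt_lim w * sqrt_lim w).
  apply: cvND; first exact: cvN_cst.
  by apply: (cvN_sqr (k := 1)) => // n; apply: sqrt_iter_le1.
move=> h1 h2; apply: cvN_uniq h2 _ => e /h1[n0 h]; exists n0 => n /h.
by rewrite /= mulrA -rsM divff ?rs1 ?mul1r// pnatr_eq0.
Qed.

Lemma sqrt_lim_bnd w : N w <= 1 -> N (sqrt_lim w) <= 1.
Proof. by move=> w1; apply: cvN_bnd (sqrt_limP w1) => n; apply: sqrt_iter_le1. Qed.

(** Intertwining covers two uses: [w = w'] says that roots commute with what commutes with [w],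
    while distinct [w] and [w'] let [neg_ust_mul] pass from [d^* d] to [d d^*]. *)
Lemma sqrt_iter_twine c w w' n : c * w = w' * c -> c * sqrt_iter w n = sqrt_iter w' n * c.
Proof.
move=> cw; elim: n => [|n IH] /=; first by rewrite mulr0 mul0r.
rewrite mulrA -rsC -!mulrA mulrDr mulrDl cw; congr (_ * (_ + _)).
by rewrite mulrA IH -!mulrA IH.
Qed.

Lemma sqrt_lim_twine c w w' : N w <= 1 -> N w' <= 1 -> c * w = w' * c ->
  c * sqrt_lim w = sqrt_lim w' * c.
Proof.
move=> w1 w1' cw; apply: (cvN_uniq (u := fun n => c * sqrt_iter w n)).
  exact: cvNMl (sqrt_limP w1).
rewrite [X in cvN X](_ : _ = (fun n => sqrt_iter w' n * c)).
  exact: cvNMr (sqrt_limP w1').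
by apply/funext => n; exact: sqrt_iter_twine.
Qed.

Lemma sqrt_iter_sa w n : ust w = w -> ust (sqrt_iter w n) = sqrt_iter w n.
Proof.
move=> ws; elim: n => [|n IH] /=; first exact: ust0.
by rewrite ustM ust_rs ustD ws ustM IH rsC.
Qed.

Lemma sqrt_lim_sa w : N w <= 1 -> ust w = w -> ust (sqrt_lim w) = sqrt_lim w.
Proof.
move=> w1 ws; apply: (cvN_uniq (u := sqrt_iter w)); last exact: sqrt_limP.
rewrite [X in cvN X](_ : _ = (fun n => ust (sqrt_iter w n))).
  exact: cvN_ust (sqrt_limP w1).
by apply/funext => n; rewrite sqrt_iter_sa.
Qed.

(* [pbound t x] bounds the spectrum of a self-adjoint [x] by [0, 2t]. *)
Definition pbound t x := 0 < t /\ N (rs t - x) <= t.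
Definition pos x := ust x = x /\ exists t, pbound t x.
(** Dividing by [t] brings [x] to the form [1 - w] with [|w| <= 1]. The scale [t] stays explicit
    because roots are intertwined, or compared modulo an ideal, at a common scale; [psqrt_indep]
    shows that the root does not depend on it. *)
Definition psqrt t x := rs (Num.sqrt t) * (1 - sqrt_lim (1 - rs t^-1 * x)).

Lemma pboundW t s x : t <= s -> pbound t x -> pbound s x.
Proof.
move=> ts [t0 h]; split; first exact: lt_le_trans ts.
have -> : rs s - x = rs (s - t) + (rs t - x) by rewrite rsD rsN; ncring.
apply: (le_trans (nmD _ _)); have := @nm_scal R U (s - t).
by rewrite ger0_norm ?subr_ge0//; lra.
Qed.

Lemma pbound_max t s x y : pbound t x -> pbound s y -> exists r, pbound r x /\ pbound r y.
Proof.
move=> tx sy; exists (Num.max t s).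
by split; [apply: pboundW tx | apply: pboundW sy]; rewrite le_max lexx ?orbT.
Qed.

Lemma pbound_arg t x : pbound t x -> N (1 - rs t^-1 * x) <= 1.
Proof.
move=> [t0 h].
have -> : 1 - rs t^-1 * x = rs t^-1 * (rs t - x).
  by rewrite mulrBr -rsM mulVf ?gt_eqF// rs1.
by rewrite nm_rs gtr0_norm ?invr_gt0// mulrC ler_pdivrMr// mul1r.
Qed.

Lemma psqrt_twine c t x x' : pbound t x -> pbound t x' -> c * x = x' * c ->
  c * psqrt t x = psqrt t x' * c.
Proof.
move=> px px' cx; rewrite /psqrt mulrA -rsC -!mulrA; congr (_ * _).
rewrite mulrBr mulrBl mulr1 mul1r; congr (_ - _).
apply: sqrt_lim_twine; try exact: pbound_arg.
by rewrite mulrBr mulrBl mulr1 mul1r mulrA -rsC -!mulrA cx.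
Qed.

Lemma psqrt_sqr t x : pbound t x -> psqrt t x * psqrt t x = x.
Proof.
move=> px; have t0 := px.1; have e := sqrt_lim_eqn (pbound_arg px).
rewrite /psqrt -mulrA [X in _ * X]mulrA -rsC -!mulrA mulrA -rsM.
rewrite -expr2 sqr_sqrtr ?ltW//.
set z := sqrt_lim _ in e *.
have -> : (1 - z) * (1 - z) = 1 - (rs 2 * z - z * z).
  have -> : rs 2 = 1 + 1 by rewrite -rs1 -rsD.
  ncring.
rewrite e addrK [X in _ * X](_ : _ = rs t^-1 * x); last by ncring.
by rewrite mulrA -rsM divff ?gt_eqF// rs1 mul1r.
Qed.

Lemma psqrt_sa t x : pbound t x -> ust x = x -> ust (psqrt t x) = psqrt t x.
Proof.
move=> px xs; rewrite /psqrt ustM ustB ust1 ust_rs -rsC sqrt_lim_sa//.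
  exact: pbound_arg.
by rewrite ustB ust1 ustM ust_rs xs rsC.
Qed.

Lemma psqrt_pos t x : pbound t x -> ust x = x -> pos (psqrt t x).
Proof.
move=> px xs; split; first exact: psqrt_sa.
exists (Num.sqrt t); have [t0 _] := px; split; first by rewrite sqrtr_gt0.
rewrite /psqrt mulrBr mulr1 opprB addrC subrK nm_rs ger0_norm ?sqrtr_ge0//.
by rewrite ler_piMr ?sqrtr_ge0// sqrt_lim_bnd ?pbound_arg.
Qed.

(** Membership of [y] in the bicommutant of [x], a substitute for [y] being a limit of polynomials
    in [x]: roots of commuting elements then commute. *)
Definition bicomm x y := forall c, c * x = x * c -> c * y = y * c.

Lemma pos_root x : pos x -> exists y, [/\ pos y, y * y = x & bicomm x y].
Proof.
move=> [xs [t px]]; exists (psqrt t x); split; first exact: psqrt_pos.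
  exact: psqrt_sqr.
by move=> c cx; apply: psqrt_twine.
Qed.

Lemma pos_sa x : pos x -> ust x = x. Proof. by case. Qed.

Lemma pbound_cst t : 0 <= t -> pbound (t + 1) (rs t).
Proof.
move=> t0; split; first lra.
rewrite -rsN -rsD addrAC subrr add0r rs1; have := @nm1_le1 R U; lra.
Qed.

Lemma pos_rs t : 0 <= t -> pos (rs t).
Proof. by move=> t0; split; [exact: ust_rs|exists (t + 1); exact: pbound_cst]. Qed.

Lemma posD x y : pos x -> pos y -> pos (x + y).
Proof.
move=> [xs [t [t0 px]]] [ys [s [s0 py]]]; split; first by rewrite ustD xs ys.
exists (t + s); split; first lra.
have -> : rs (t + s) - (x + y) = (rs t - x) + (rs s - y) by rewrite rsD; ncring.
by apply: (le_trans (nmD _ _)); lra.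
Qed.

Lemma pos0 : pos 0. Proof. by rewrite -(@rs0 R U); apply: pos_rs. Qed.

Lemma posZ t x : 0 <= t -> pos x -> pos (rs t * x).
Proof.
rewrite le_eqVlt => /predU1P[<-|t0]; first by rewrite rs0 mul0r => _; exact: pos0.
move=> [xs [s [s0 px]]]; split; first by rewrite ustM ust_rs xs rsC.
exists (t * s); split; first exact: mulr_gt0.
by rewrite rsM -mulrBr nm_rs gtr0_norm// ler_pM2l.
Qed.

Lemma pos_nm_sub h t : ust h = h -> N h <= t -> pos (rs t - h).
Proof.
move=> hs ht; split; first by rewrite ustB ust_rs hs.
exists (t + 1); have := nm_ge0 h => h0; split; first lra.
have -> : rs (t + 1) - (rs t - h) = rs 1 + h by rewrite rsD; ncring.
apply: (le_trans (nmD _ _)); rewrite rs1; have := @nm1_le1 R U; lra.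
Qed.

(* The unitary trick: [(h + iy)^* (h + iy) = c^2]. *)
Lemma circle_bnd h y (c : R) : 0 <= c -> ust h = h -> ust y = y -> h * y = y * h ->
  h * h + y * y = rs (c ^+ 2) -> N h <= c.
Proof.
move=> c0 hs ys hy e; pose u : U := h + 'i *: y.
have ui : ust u = h - 'i *: y.
  by rewrite /u ustD ustZ hs ys -scaleNr; congr (_ + _ *: _); simpc.
have uu : ust u * u = rs (c ^+ 2).
  rewrite ui /u mulrBl !mulrDr -!scalerAl -!scalerAr scalerA -[y * h]hy.
  have -> : 'i * 'i = -1 :> R[i] by simpc.
  by rewrite scaleN1r -e; ncring.
have Nu : N u <= c.
  have := nm_ust_mul u; rewrite uu => e2.
  have := @nm_scal R U (c ^+ 2); rewrite e2 ger0_norm ?sqr_ge0//.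
  by rewrite ler_sqr// nnegrE ?nm_ge0.
have -> : h = rs 2^-1 * (u + ust u).
  have -> : u + ust u = rs 2 * h.
    rewrite ui /u; have -> : rs 2 = 1 + 1 by rewrite -rs1 -rsD.
    ncring.
  by rewrite mulrA -rsM mulVf ?pnatr_eq0// rs1 mul1r.
rewrite nm_rs ger0_norm; last lra.
have := nmD u (ust u); rewrite nm_ust; lra.
Qed.

Lemma bicomm2 x y x' y' : bicomm x y -> bicomm x' y' -> x * x' = x' * x ->
  y * y' = y' * y.
Proof. by move=> b b' c; apply: b'; apply/esym/b/esym. Qed.

(* [t - x = y^2] and [t + x = w^2] give [x^2 + (y w)^2 = t^2]. *)
Lemma nm_le_pos x t : pos (rs t - x) -> pos (rs t + x) -> 0 <= t -> N x <= t.
Proof.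
move=> /pos_root[y [py ey by_]] /pos_root[w [pw ew bw]] t0.
have sx : ust x = x.
  have : ust (w * w) = w * w by rewrite ustM pos_sa.
  by rewrite ew ustD ust_rs => /addrI.
have yw : y * w = w * y.
  by apply: bicomm2 by_ bw _; rewrite !(mulrDl, mulrDr, mulrN, mulNr) (rsC t x); ncring.
have xx c : c = y \/ c = w -> c * x = x * c.
  move=> hc; have : c * (rs t + x) = (rs t + x) * c.
    by rewrite -ew; case: hc => ->; rewrite ?mulrA// yw -mulrA yw mulrA.
  by rewrite mulrDr mulrDl rsC => /addrI.
apply: (circle_bnd (y := y * w)) => //.
- by rewrite ustM !pos_sa.
- by rewrite mulrA -(xx y) ?(xx w)//; [rewrite -mulrA -(xx w) ?mulrA//; right|left].
have -> : y * w * (y * w) = (y * y) * (w * w).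
  by rewrite -!mulrA [w * (y * w)]mulrA -yw !mulrA.
by rewrite ey ew expr2 rsM !(mulrDl, mulrDr, mulrN, mulNr) (rsC t x); ncring.
Qed.

(** For [t = |h|^2 + 1] and [y] a root of [t - h^2], the circle [y^2 + h^2 = t] gives [|y|^2 <= t],
    that is [|t - h^2| <= t]. The summand 1 keeps [t] positive when [h = 0]. *)
Lemma pos_sqr h : ust h = h -> pos (h * h).
Proof.
move=> hs; set t := N h ^+ 2 + 1.
have t0 : 0 < t by rewrite ltr_wpDl ?sqr_ge0.
have sh : ust (h * h) = h * h by rewrite ustM hs.
split=> //; exists t; split=> //.
have px : pbound t (rs t - h * h).
  split=> //; rewrite opprB addrC subrK nm_sa_sqr// /t; lra.
have sx : ust (rs t - h * h) = rs t - h * h by rewrite ustB ust_rs sh.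
have y2 := psqrt_sqr px; have ys := psqrt_sa px sx; move: (psqrt t _) y2 ys
  (@psqrt_twine h t _ _ px px) => y y2 ys yh.
have {}yh : h * y = y * h by apply: yh; rewrite mulrBr mulrBl rsC mulrA.
have Ny : N y <= Num.sqrt t.
  apply: (circle_bnd (y := h)); rewrite ?sqrtr_ge0//.
  by rewrite y2 subrK sqr_sqrtr// ltW.
rewrite -y2 nm_sa_sqr// -[leRHS]sqr_sqrtr ?(ltW t0)//.
by rewrite ler_sqr// nnegrE ?nm_ge0 ?sqrtr_ge0.
Qed.

Lemma posM x y : pos x -> pos y -> x * y = y * x -> pos (x * y).
Proof.
move=> /pos_root[z [pz <- bz]] /pos_root[w [pw <- bw]] /(bicomm2 bz bw) zw.
have -> : z * z * (w * w) = (z * w) * (z * w).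
  by rewrite -!mulrA [w * (z * w)]mulrA -zw !mulrA.
by apply: pos_sqr; rewrite ustM !pos_sa.
Qed.

Lemma pos_anti x : pos x -> pos (- x) -> x = 0.
Proof.
move=> px nx; apply: nm_eq0; apply/eqP; rewrite eq_le nm_ge0 andbT.
by apply: nm_le_pos; rewrite ?rs0 ?add0r ?sub0r.
Qed.

(** With [d = x - y], the positive elements [d x d] and [d y d] add up to [d (x^2 - y^2) = 0], so
    both vanish. Their difference is [d^3], hence [d^4 = 0], and the C*-identity used twice gives
    [d = 0]. *)
Lemma pos_root_uniq x y : pos x -> pos y -> x * y = y * x -> x * x = y * y ->
  x = y.
Proof.
move=> px py xy e; pose d := x - y.
have ds : ust d = d by rewrite ustB !pos_sa.
have dd z : pos z -> d * z = z * d -> pos (d * z * d).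
  move=> pz dz; rewrite dz -mulrA; apply: posM => //; first exact: pos_sqr.
  by rewrite mulrA -dz -!mulrA -dz.
have dx : d * x = x * d by rewrite /d mulrBr mulrBl xy.
have dy : d * y = y * d by rewrite /d mulrBr mulrBl xy.
have e0 : d * x * d + d * y * d = 0.
  rewrite -mulrDl -mulrDr /d mulrDr !mulrBl e xy; ncring.
have x0 : d * x * d = 0.
  apply: pos_anti; first exact: dd.
  rewrite (_ : - _ = d * y * d); first exact: dd.
  by apply: (addrI (d * x * d)); rewrite subrr e0.
have y0 : d * y * d = 0 by move: e0; rewrite x0 add0r.
have : d * d * (d * d) = 0.
  have -> : d * d * (d * d) = d * (d * x * d) - d * (d * y * d).
    rewrite -mulrBr -mulrBl -mulrBr -/d -!mulrA //.
  by rewrite x0 y0 !mulr0 subrr.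
move=> /sqr_eq0_sa h; apply/eqP; rewrite -subr_eq0; apply/eqP.
by apply: sqr_eq0_sa => //; apply: h; rewrite ustM ds.
Qed.

(* [k = |h|]; with [q = k - h] and [c = |q|], the difference [e = c - q]
   satisfies [e^2 = 2 c e] and [(c e)^2 + 2 k c e^2 = 0]. *)
Lemma pos_abs_sub k h : pos k -> ust h = h -> k * h = h * k -> k * k = h * h ->
  pos (k - h).
Proof.
move=> pk hs kh e2; have [q qE] : exists q, q = k - h by exists (k - h).
have sq : ust q = q by rewrite qE ustB pos_sa// hs.
have q2 : q * q = rs 2 * (k * q).
  have -> : rs 2 = 1 + 1 by rewrite -rs1 -rsD.
  by rewrite qE !(mulrBr, mulrBl, mulrDl) -e2 kh; ncring.
have [c [pc c2 bc]] := pos_root (pos_sqr sq).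
have qc : q * c = c * q by apply: bc; rewrite mulrA.
have kq : k * q = q * k by rewrite qE mulrBr mulrBl kh.
have kc : k * c = c * k by apply: bc; rewrite mulrA kq -!mulrA kq.
have [e eE] : exists e, e = c - q by exists (c - q).
have se : ust e = e by rewrite eE ustB pos_sa// sq.
have ee : e * e = rs 2 * (c * e).
  have -> : rs 2 = 1 + 1 by rewrite -rs1 -rsD.
  by rewrite eE !(mulrBr, mulrBl, mulrDl) c2 qc; ncring.
have ce : c * e = e * c by rewrite eE mulrBr mulrBl qc.
have ke : k * e = e * k by rewrite eE mulrBr mulrBl kc kq.
have qe : q * e = - (c * e).
  by rewrite eE !mulrBr c2 qc; ncring.
have E : c * c * e + rs 2 * (k * (c * e)) = 0.
  have -> : k * (c * e) = - (k * (q * e)) by rewrite qe mulrN opprK.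
  by rewrite mulrN !mulrA -[rs 2 * k * q]mulrA -q2 c2 subrr.
have pkc : pos (k * c) by apply: posM.
have pce : pos ((c * e) * (c * e)).
  by apply: pos_sqr; rewrite ustM se pos_sa.
have pke : pos (rs 2 * ((k * c) * (e * e))).
  apply: posZ => //; apply: posM => //; first exact: pos_sqr.
  have kce : GRing.comm (k * c) e by apply/commr_sym/commrM; apply/commr_sym.
  exact: commrM.
have E2 : (c * e) * (c * e) + rs 2 * ((k * c) * (e * e)) = 0.
  rewrite -[RHS](mul0r e) -E mulrDl -!mulrA; congr (_ + _).
  by rewrite [e * (c * e)]mulrA -ce !mulrA.
have ce0 : c * e = 0.
  apply: sqr_eq0_sa; first by rewrite ustM se pos_sa.
  apply: pos_anti => //; rewrite (_ : - _ = rs 2 * ((k * c) * (e * e)))//.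
  by apply: (addrI (c * e * (c * e))); rewrite subrr E2.
have : e = 0 by apply: sqr_eq0_sa => //; rewrite ee ce0 mulr0.
by move/eqP; rewrite eE subr_eq0 -qE => /eqP <-.
Qed.

Lemma ust_mul_sa x : ust (ust x * x) = ust x * x.
Proof. by rewrite ustM ustK. Qed.

Lemma psqrt_indep t s x : pbound t x -> pbound s x -> ust x = x -> psqrt t x = psqrt s x.
Proof.
move=> pt ps xs; apply: pos_root_uniq; try exact: psqrt_pos.
  apply: psqrt_twine => //; apply/esym/psqrt_twine => //.
by rewrite !psqrt_sqr.
Qed.

(** For self-adjoint [h], [psqrt t (h * h)] is the absolute value of [h]; here it is seen to fix
    positive elements. *)
Lemma psqrt_abs t x : pos x -> pbound t (x * x) -> psqrt t (x * x) = x.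
Proof.
move=> px pt; apply: pos_root_uniq => //.
- by apply: psqrt_pos => //; rewrite ustM pos_sa.
- by apply/esym/psqrt_twine => //; rewrite mulrA.
- exact: psqrt_sqr.
Qed.

Lemma self_oppr_eq0 x : x = - x -> x = 0.
Proof.
move=> e; have : rs 2^-1 * (x + x) = x.
  have -> : x + x = rs 2 * x by rewrite (rsD 1 1) rs1 mulrDl mul1r.
  by rewrite mulrA -rsM mulVf ?pnatr_eq0// rs1 mul1r.
by rewrite {2}e subrr mulr0.
Qed.

(* If [d^* d <= 0], then [d d^* >= 0] as [d d^* + d^* d] is a sum of squares, and
   [d] intertwines [k = - d^* d] and [d d^*] up to a sign. *)
Lemma neg_ust_mul d : pos (- (ust d * d)) -> d = 0.
Proof.
have [k kE] : exists k, k = - (ust d * d) by exists (- (ust d * d)).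
have [m mE] : exists m, m = d * ust d by exists (d * ust d).
rewrite -kE => pk; apply: ust_mul_eq0.
have pm : pos m.
  pose a := d + ust d; pose b := 'i *: (d - ust d).
  have sa : ust a = a by rewrite ustD ustK addrC.
  have sb : ust b = b.
    by rewrite ustZ ustB ustK -opprB scalerN -scaleNr; congr (_ *: _); simpc.
  have : pos (rs 2^-1 * (a * a + b * b) + k).
    apply: posD => //; apply: posZ; first by rewrite invr_ge0.
    by apply: posD; exact: pos_sqr.
  congr pos; have -> : a * a + b * b = rs 2 * (m + ust d * d).
    rewrite /b -scalerAl -scalerAr scalerA.
    have -> : 'i * 'i = -1 :> R[i] by simpc.
    have -> : rs 2 = 1 + 1 by rewrite -rs1 -rsD.
    by rewrite scaleN1r /a mE; ncring.
  by rewrite mulrA -rsM mulVf ?pnatr_eq0// rs1 mul1r kE; ncring.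
have [t [pt1 pt2]] : exists t, pbound t (m * m) /\ pbound t (k * k).
  have [_ [t1 p1]] := pos_sqr (pos_sa pm).
  have [_ [t2 p2]] := pos_sqr (pos_sa pk); exact: pbound_max p1 p2.
have md : m * d = - (d * k) by rewrite mE kE mulrN opprK mulrA.
(* Squaring removes the sign in [m d = - d k], so [d] intertwines [k^2] and [m^2]. Taking roots
   gives [d k = m d], which is also [- d k]. *)
have := psqrt_twine (c := d) pt2 pt1; rewrite !psqrt_abs// md.
have -> : d * (k * k) = m * m * d.
  by rewrite -[m * m * d]mulrA md mulrN [m * (d * k)]mulrA md mulNr opprK -mulrA.
move=> /(_ erefl) dk.
have dk0 : d * k = 0 by apply: self_oppr_eq0.
have : k * k = 0 by rewrite {1}kE mulNr -mulrA dk0 mulr0 oppr0.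
by move/(sqr_eq0_sa (pos_sa pk))/eqP; rewrite kE oppr_eq0 => /eqP.
Qed.

(** Let [h = b^* b], let [k] be its absolute value, and let [q = k - h], twice the negative part,
    with root [c]. Then [d = b c] satisfies [d^* d = h q = - k q <= 0], so [d = 0] by [neg_ust_mul].
    Thus [h q = k q = 0], whence [q^2 = 0] and [h = k]. *)
Lemma pos_ust_mul b : pos (ust b * b).
Proof.
have [h hE] : exists h, h = ust b * b by exists (ust b * b).
have hs : ust h = h by rewrite hE ust_mul_sa.
have [k [pk kk bk]] := pos_root (pos_sqr hs).
have kh : k * h = h * k by apply/esym/bk; rewrite mulrA.
have [q qE] : exists q, q = k - h by exists (k - h).
have pq : pos q by rewrite qE; exact: pos_abs_sub.
have hq : h * q = - (k * q) by rewrite qE !mulrBr kk kh opprB.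
have qh : h * q = q * h by rewrite qE mulrBr mulrBl kh.
have kq : k * q = q * k by rewrite qE mulrBr mulrBl kh.
have [c [pc cc bc]] := pos_root pq.
have dd : ust (b * c) * (b * c) = h * q.
  by rewrite ustM pos_sa// mulrA -[c * _ * b]mulrA -hE -(bc _ qh) -mulrA cc.
have : b * c = 0 by apply: neg_ust_mul; rewrite dd hq opprK; exact: posM.
move=> d0; have {}dd : h * q = 0 by rewrite -dd d0 mulr0.
have : q = 0.
  apply: sqr_eq0_sa; first exact: pos_sa.
  have kq0 : k * q = 0 by apply/oppr_inj; rewrite -hq dd oppr0.
  by rewrite {1}qE mulrBl kq0 dd subrr.
by move/eqP; rewrite qE subr_eq0 -hE => /eqP <-.
Qed.

(** * Square roots and absolute values modulo a closed ideal *)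

Definition uideal (I : set U) := [/\ I 0,
  forall x y, I x -> I y -> I (x - y),
  forall a x, I x -> I (a * x) /\ I (x * a) &
  forall u z, (forall n, I (u n)) -> cvN u z -> I z].

Section Ideal.
Variables (I : set U) (Iid : uideal I).

Lemma uidealB x y : I x -> I y -> I (x - y). Proof. by case: Iid => _ + _ _; apply. Qed.
Lemma uidealN x : I x -> I (- x).
Proof. by rewrite -sub0r; apply: uidealB; case: Iid. Qed.
Lemma uidealD x y : I x -> I y -> I (x + y).
Proof. by move=> Ix Iy; rewrite -[y]opprK; apply/uidealB/uidealN. Qed.
Lemma uidealMl a x : I x -> I (a * x).
Proof. by case: Iid => _ _ h _ /(h a)[]. Qed.
Lemma uidealMr a x : I x -> I (x * a).
Proof. by case: Iid => _ _ h _ /(h a)[]. Qed.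

Lemma sqrt_iter_mod w w' n : I (w - w') -> I (sqrt_iter w n - sqrt_iter w' n).
Proof.
move=> Iw; elim: n => [|n IH] /=; first by rewrite subrr; case: Iid.
rewrite -mulrBr; apply: uidealMl.
have -> : w + sqrt_iter w n * sqrt_iter w n -
    (w' + sqrt_iter w' n * sqrt_iter w' n) = (w - w') +
  (sqrt_iter w n * (sqrt_iter w n - sqrt_iter w' n) +
   (sqrt_iter w n - sqrt_iter w' n) * sqrt_iter w' n) by ncring.
by do 2 apply: uidealD => //; [exact: uidealMl|exact: uidealMr].
Qed.

Lemma sqrt_lim_mod w w' : N w <= 1 -> N w' <= 1 -> I (w - w') -> I (sqrt_lim w - sqrt_lim w').
Proof.
move=> w1 w1' Iw; have [_ _ _ Ic] := Iid.
apply: (Ic (fun n => sqrt_iter w n - sqrt_iter w' n)) => [n|]; first exact: sqrt_iter_mod.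
have := cvND (sqrt_limP w1) (cvNMl (- 1) (sqrt_limP w1')); rewrite mulN1r.
by congr (cvN _ _); apply/funext => n; rewrite mulN1r.
Qed.

Lemma psqrt_mod t x x' : pbound t x -> pbound t x' -> I (x - x') -> I (psqrt t x - psqrt t x').
Proof.
move=> px px' Ix; rewrite /psqrt -mulrBr; apply: uidealMl.
have -> : forall a b : U, 1 - a - (1 - b) = b - a by move=> *; ncring.
apply: sqrt_lim_mod; try exact: pbound_arg.
have -> : forall a b : U, 1 - a - (1 - b) = b - a by move=> *; ncring.
by rewrite -mulrBr; exact: uidealMl.
Qed.

(** [x] and [x + l] have squares that agree modulo [I], so their absolute values agree modulo [I];
    that of the positive element [x + l] is itself. The scale is enlarged to one valid for both
    squares before comparing roots. *)
Lemma abs_mod t x l : ust x = x -> pbound t (x * x) -> I l -> pos (x + l) ->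
  I (psqrt t (x * x) - x).
Proof.
move=> xs px Il pxl.
have [_ [s ps]] := pos_sqr (pos_sa pxl).
have [r [pr pr']] := pbound_max px ps.
rewrite (psqrt_indep px pr); last by rewrite ustM xs.
have -> : psqrt r (x * x) - x = psqrt r (x * x) - psqrt r ((x + l) * (x + l)) + l.
  by rewrite (psqrt_abs pxl pr'); ncring.
apply: uidealD => //; apply: psqrt_mod => //.
have -> : x * x - (x + l) * (x + l) = - (l * (x + l) + x * l) by ncring.
by apply/uidealN/uidealD; [exact: uidealMr|exact: uidealMl].
Qed.

(* Modulo [I], [h] agrees with its truncation [(|h + e| - |h - e|) / 2]. *)
Lemma small_mod h e l l' : 0 < e -> ust h = h -> I l -> I l' ->
  pos (rs e - h - l) -> pos (rs e + h - l') -> exists2 i, I i & N (h - i) <= e.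
Proof.
move=> e0 hs Il Il' pl pl'.
have [u uE] : exists u, u = rs e + h by exists (rs e + h).
have [v vE] : exists v, v = rs e - h by exists (rs e - h).
have us : ust u = u by rewrite uE ustD ust_rs hs.
have vs : ust v = v by rewrite vE ustB ust_rs hs.
have uv : u * v = v * u.
  by rewrite uE vE !(mulrDl, mulrDr, mulrN, mulNr) (rsC e h); ncring.
have [t [pu pv]] : exists t, pbound t (u * u) /\ pbound t (v * v).
  have [_ [t1 p1]] := pos_sqr us; have [_ [t2 p2]] := pos_sqr vs.
  exact: pbound_max p1 p2.
have Ia : I (psqrt t (u * u) - u).
  by apply: (abs_mod (l := - l')) => //; [exact: uidealN | rewrite uE].
have Ib : I (psqrt t (v * v) - v).
  by apply: (abs_mod (l := - l)) => //; [exact: uidealN | rewrite vE].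
have ba : bicomm (u * u) (psqrt t (u * u)) by move=> c; apply: psqrt_twine.
have bb : bicomm (v * v) (psqrt t (v * v)) by move=> c; apply: psqrt_twine.
have a2 := psqrt_sqr pu; have b2 := psqrt_sqr pv.
have pa : pos (psqrt t (u * u)) by apply: psqrt_pos => //; rewrite ustM us.
have pbound' : pos (psqrt t (v * v)) by apply: psqrt_pos => //; rewrite ustM vs.
move: (psqrt t (u * u)) (psqrt t (v * v)) Ia Ib ba bb a2 b2 pa pbound'.
move=> a b Ia Ib ba bb a2 b2 pa pbound'.
have uu_vv : u * u * (v * v) = v * v * (u * u).
  by apply: commrM; apply/commr_sym/commrM.
have ab : a * b = b * a by apply: bicomm2 ba bb _.
have uvu : GRing.comm (u * v) u := commr_sym (commrM (commr_refl u) uv).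
have uvv : GRing.comm (u * v) v.
  exact: commr_sym (commrM (commr_sym uv) (commr_refl v)).
(* Here [g = h^2 - e^2] and [(a b)^2 = g^2], so [a b - g] is positive. With [p^2 = 2 (a b - g)] one
   gets [(a - b)^2 + p^2 = (2 e)^2], a circle that bounds [a - b] by [2 e]. *)
have [g gE] : exists g, g = - (u * v) by exists (- (u * v)).
have gs : ust g = g by rewrite gE ustN ustM us vs uv.
have ga : a * g = g * a.
  apply/esym/ba; rewrite gE mulNr mulrN; congr (- _).
  exact: commrM.
have gb : b * g = g * b.
  apply/esym/bb; rewrite gE mulNr mulrN; congr (- _).
  exact: commrM.
have pabg : pos (a * b - g).
  apply: pos_abs_sub => //; first exact: posM.
    by apply/commr_sym/commrM.
  rewrite gE mulrNN -[RHS]mulrA [v * (u * v)]mulrA -uv -!mulrA.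
  by rewrite [b * (a * b)]mulrA -ab -mulrA b2 mulrA a2 mulrA !mulrA.
have [p [pp p2 bp]] := pos_root (posZ (ler0n R 2) pabg).
have abs : ust (a - b) = a - b by rewrite ustB !pos_sa.
have Nab : N (a - b) <= 2 * e.
  apply: (circle_bnd (y := p)) => //; first lra; first exact: pos_sa.
    apply: bp; rewrite mulrA -rsC -!mulrA; congr (_ * _).
    have aab : GRing.comm a (a * b - g).
      by apply: commrB => //; apply: commrM.
    have bab : GRing.comm b (a * b - g).
      by apply: commrB => //; apply: commrM => //; apply: commr_sym.
    exact: commr_sym (commrB (commr_sym aab) (commr_sym bab)).
  have -> : rs ((2 * e) ^+ 2) = (1 + 1) * (1 + 1) * (rs e * rs e).
    have -> : rs ((2 * e) ^+ 2) = rs 2 * rs 2 * (rs e * rs e).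
      by rewrite -!rsM; congr (rs _); ring.
    by have -> : rs 2 = 1 + 1 by rewrite -rs1 -rsD.
  rewrite p2; have -> : rs 2 = 1 + 1 by rewrite -rs1 -rsD.
  rewrite mulrBl !mulrBr a2 b2 ab gE uE vE.
  by rewrite !(mulrDl, mulrDr, mulrN, mulNr) (rsC e h); ncring.
exists (h - rs 2^-1 * (a - b)).
  have -> : h - rs 2^-1 * (a - b) = - (rs 2^-1 * (a - u - (b - v))).
    have -> : a - u - (b - v) = (a - b) - rs 2 * h.
      rewrite uE vE; have -> : rs 2 = 1 + 1 by rewrite -rs1 -rsD.
      ncring.
    rewrite [in RHS]mulrBr [rs 2^-1 * (rs 2 * h)]mulrA -rsM mulVf ?pnatr_eq0//.
    by rewrite rs1 mul1r opprB.
  by apply/uidealN/uidealMl/uidealB.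
rewrite opprB addrC subrK nm_rs ger0_norm ?invr_ge0//.
by move: Nab; lra.
Qed.

End Ideal.
End Roots.

(** * Extreme functionals below a sublinear functional *)

Section Sublinear.
Context {R : realType} {V : lmodType R[i]}.
Implicit Types (p q f : V -> R) (x y : V) (t s : R).

Definition rlin f := (forall x y, f (x + y) = f x + f y) /\
  (forall t x, f (t%:C *: x) = t * f x).
Definition sublin p := (forall x y, p (x + y) <= p x + p y) /\
  (forall t x, 0 <= t -> p (t%:C *: x) = t * p x).

Lemma sublin0 p : sublin p -> p 0 = 0.
Proof. by move=> [_ h]; rewrite -(scale0r 0) (h 0)// mul0r. Qed.
Lemma sublinN p x : sublin p -> - p (- x) <= p x.
Proof. by move=> hp; have := hp.1 x (- x); rewrite subrr sublin0//; lra. Qed.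
Lemma rlinN f x : rlin f -> f (- x) = - f x.
Proof.
move=> [h _]; have := h x (- x); rewrite subrr.
by have := h 0 0; rewrite addr0; lra.
Qed.

Lemma rlin_le_eq f f' : rlin f -> rlin f' -> (forall x, f x <= f' x) -> f = f'.
Proof.
move=> hf hf' le; apply/funext => x; apply/eqP; rewrite eq_le le /=.
by have := le (- x); rewrite !rlinN// lerN2.
Qed.

Section Cone.
Variables (p : V -> R) (G : set (V * R)).
Hypotheses (hp : sublin p) (G0 : G (0, 0))
  (GD : forall u v, G u -> G v -> G (u.1 + v.1, u.2 + v.2))
  (GZ : forall t u, 0 <= t -> G u -> G (t%:C *: u.1, t * u.2))
  (Gp : forall u, G u -> u.2 <= p u.1).

(* The largest sublinear [q <= p] with [f <= q] iff [f <= p] and [f c >= r] for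
   all [(c, r)] in [G]. *)
Definition cone_cut x := inf [set p (x + u.1) - u.2 | u in G].

Lemma cone_cut_has_inf x : has_inf [set p (x + u.1) - u.2 | u in G].
Proof.
split; first by exists (p (x + 0) - 0), (0, 0).
exists (- p (- x)) => _ [u /Gp Gu <-].
by have := hp.1 (x + u.1) (- x); rewrite addrAC subrr add0r; lra.
Qed.

Lemma cone_cut_le x u : G u -> cone_cut x <= p (x + u.1) - u.2.
Proof.
by move=> Gu; apply: ge_inf; [exact: (cone_cut_has_inf x).2|exists u].
Qed.

Lemma le_cone_cut x t : (forall u, G u -> t <= p (x + u.1) - u.2) -> t <= cone_cut x.
Proof.
move=> h; apply: lb_le_inf; first exact: (cone_cut_has_inf x).1.
by move=> _ [u Gu <-]; apply: h.
Qed.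

Lemma cone_cut_le_p x : cone_cut x <= p x.
Proof. by have := cone_cut_le x G0; rewrite addr0 subr0. Qed.

(** For a linear [f] below the cut this reads [f u.1 >= u.2]: the constraint is recovered from the
    sublinear bound. [rlin_le_cone_cut] is the converse. *)
Lemma cone_cutN u : G u -> cone_cut (- u.1) <= - u.2.
Proof. by move=> /(cone_cut_le (- u.1)); rewrite addNr sublin0// sub0r. Qed.

Lemma cone_cut_sublin : sublin cone_cut.
Proof.
split=> [x y|t x].
  rewrite -lerBlDr; apply: le_cone_cut => u Gu; rewrite lerBlDr -lerBlDl.
  apply: le_cone_cut => v Gv; rewrite lerBlDl.
  apply: le_trans (cone_cut_le (x + y) (GD Gu Gv)) _ => /=.
  by have := hp.1 (x + u.1) (y + v.1); rewrite addrACA; lra.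
have le s y : 0 < s -> cone_cut (s%:C *: y) <= s * cone_cut y.
  move=> s0; rewrite -ler_pdivrMl//; apply: le_cone_cut => u Gu.
  rewrite ler_pdivrMl//; apply: le_trans (cone_cut_le _ (GZ (ltW s0) Gu)) _ => /=.
  by rewrite -scalerDr (hp.2 _ _ (ltW s0)) mulrBr.
rewrite le_eqVlt => /predU1P[<-|t0].
  rewrite scale0r mul0r; apply/eqP; rewrite eq_le.
  have := cone_cut_le_p 0; rewrite (sublin0 hp) => -> /=.
  by apply: le_cone_cut => u Gu; rewrite add0r subr_ge0 Gp.
apply/eqP; rewrite eq_le le//=.
rewrite -ler_pdivlMl//; have ti : 0 < t^-1 by rewrite invr_gt0.
apply: le_trans (le _ _ ti); rewrite scalerA -rmorphM mulVf ?gt_eqF//.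
by rewrite scale1r.
Qed.

Lemma rlin_le_cone_cut f : rlin f -> (forall x, f x <= p x) ->
  (forall u, G u -> u.2 <= f u.1) -> forall x, f x <= cone_cut x.
Proof.
move=> hf fp fG x; apply: le_cone_cut => u Gu.
by have := fp (x + u.1); rewrite hf.1; have := fG _ Gu; lra.
Qed.

End Cone.

(** The linear functionals below [q] form a face of those below [p]. Faces are thus described by
    sublinear functionals, and the minimal face of the Krein-Milman argument becomes a minimal such
    functional. *)
Definition facial p q := forall f1 f2 s, rlin f1 -> rlin f2 ->
  (forall x, f1 x <= p x) -> (forall x, f2 x <= p x) -> 0 < s < 1 ->
  (forall x, s * f1 x + (1 - s) * f2 x <= q x) ->
  (forall x, f1 x <= q x) /\ (forall x, f2 x <= q x).

Record face p := Face { face_fun :> V -> R ;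
  face_sublin : sublin face_fun ;
  face_le : forall x, face_fun x <= p x ;
  face_facial : facial p face_fun }.

Lemma face_inj p (q q' : face p) : face_fun q = face_fun q' -> q = q'.
Proof.
case: q q' => [q a b c] [q' a' b' c'] /= e; subst q'.
by congr Face; exact: Prop_irrelevance.
Qed.

Lemma face_bound p (q : face p) x : - p (- x) <= q x.
Proof.
by apply: le_trans (sublinN x (face_sublin q)); rewrite lerN2 face_le.
Qed.

(** The order is reversed, so that a maximal element in Zorn's lemma is a minimal functional. *)
Definition face_ge p (q q' : face p) : bool := `[< forall x, q' x <= q x >].

Lemma face_chain p (A : set (face p)) : sublin p ->
  total_on A (@face_ge p) -> exists a0 : face p, forall a, A a -> face_ge a a0.
Proof.
move=> hp totA; have [[q0 Aq0]|nA] := pselect (exists q : face p, A q); last first.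
  (* The empty chain is bounded by [p] itself. *)
  have fp : facial p p by [].
  by exists (Face hp (fun=> lexx _) fp) => s As; exfalso; apply: nA; exists s.
pose q x := inf [set (s : face p) x | s in A].
have hinf x : has_inf [set (s : face p) x | s in A].
  split; first by exists (q0 x), q0.
  by exists (- p (- x)) => _ [s _ <-]; exact: face_bound.
have q_le (s : face p) x : A s -> q x <= s x.
  by move=> As; apply: ge_inf; [exact: (hinf x).2|exists s].
have le_q t x : (forall s : face p, A s -> t <= s x) -> t <= q x.
  move=> h; apply: lb_le_inf; first exact: (hinf x).1.
  by move=> _ [s As <-]; exact: h.
have qs : sublin q.
  split=> [x y|t x t0].
    rewrite -lerBlDr; apply: (le_q) => s As; rewrite lerBlDr -lerBlDl.
    apply: (le_q) => s' As'; rewrite lerBlDl.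
    (* Subadditivity of a pointwise infimum uses totality: the smaller of [s] and [s'] is taken at
       both points. *)
    have [/asboolP h|/asboolP h] := totA _ _ As As'.
      apply: le_trans (q_le _ _ As') _.
      by apply: le_trans ((face_sublin s').1 _ _) _; rewrite lerD2r.
    apply: le_trans (q_le _ _ As) _.
    by apply: le_trans ((face_sublin s).1 _ _) _; rewrite lerD2l.
  move: t0; rewrite le_eqVlt => /predU1P[<-|t0].
    rewrite scale0r mul0r; apply/eqP; rewrite eq_le; apply/andP; split.
      by apply: le_trans (q_le _ _ Aq0) _; rewrite sublin0//; exact: face_sublin.
    by apply: (le_q) => s _; rewrite sublin0//; exact: face_sublin.
  apply/eqP; rewrite eq_le; apply/andP; split.
    rewrite -ler_pdivrMl//; apply: (le_q) => s As; rewrite ler_pdivrMl//.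
    by rewrite -(face_sublin s).2 ?q_le// ltW.
  apply: (le_q) => s As; rewrite (face_sublin s).2 ?(ltW t0)//.
  by rewrite ler_pM2l// q_le.
have qp x : q x <= p x by apply: le_trans (q_le _ _ Aq0) (face_le q0 x).
have qf : facial p q.
  move=> f1 f2 s h1 h2 l1 l2 s01 h.
  have hs a : A a -> (forall x, f1 x <= a x) /\ (forall x, f2 x <= a x).
    move=> Aa; apply: (face_facial h1 h2 l1 l2 s01) => x.
    exact: le_trans (h x) (q_le _ _ Aa).
  by split=> x; apply: (le_q) => a /hs[].
by exists (Face qs qp qf) => s As; apply/asboolP => x; exact: q_le.
Qed.

(* A minimal facial sublinear functional is linear: cutting it by
   [f x0 >= q x0] cannot make it smaller. *)
Theorem extreme_le_sublin p : sublin p -> exists f, [/\ rlin f,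
  (forall x, f x <= p x) &
  forall f1 f2 s, rlin f1 -> rlin f2 ->
    (forall x, f1 x <= p x) -> (forall x, f2 x <= p x) -> 0 < s < 1 ->
    (forall x, f x = s * f1 x + (1 - s) * f2 x) -> f1 = f /\ f2 = f].
Proof.
move=> hp.
have [||||q qmin] := @Zorn (face p) (@face_ge p).
- by move=> t; apply/asboolP.
- move=> r s t /asboolP rs /asboolP st; apply/asboolP => x.
  exact: le_trans (st x) (rs x).
- move=> s t /asboolP st /asboolP ts; apply/face_inj/funext => x.
  by apply/eqP; rewrite eq_le ts st.
- by move=> A; exact: face_chain.
have hq := face_sublin q.
have qN x0 : q (- x0) = - q x0.
  pose G := [set u : V * R | exists2 t, 0 <= t & u = (t%:C *: x0, t * q x0)].
  have G0 : G (0, 0) by exists 0 => //; rewrite scale0r mul0r.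
  have GD u v : G u -> G v -> G (u.1 + v.1, u.2 + v.2).
    move=> [t t0 ->] [s s0 ->]; exists (t + s); first exact: addr_ge0.
    by rewrite rmorphD scalerDl mulrDl.
  have GZ t u : 0 <= t -> G u -> G (t%:C *: u.1, t * u.2).
    move=> t0 [s s0 ->]; exists (t * s); first exact: mulr_ge0.
    by rewrite rmorphM -scalerA mulrA.
  have Gq u : G u -> u.2 <= q u.1 by move=> [t t0 ->] /=; rewrite hq.2.
  have G1 : G (x0, q x0) by exists 1 => //; rewrite scale1r mul1r.
  have lqq := cone_cut_le_p hq G0 Gq.
  have qN' := cone_cutN hq G0 Gq G1.
  have cf : facial p (cone_cut q G).
    move=> f1 f2 s h1 h2 l1 l2 s01 h.
    have [k1 k2] := face_facial h1 h2 l1 l2 s01 (fun x => le_trans (h x) (lqq x)).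
    (* At [x0] the combination is at least [q x0] and each of [f1], [f2] is at most [q x0]. Both
       therefore equal [q x0] there and meet the constraint of the cut. *)
    have := le_trans (h _) qN'; rewrite /= !rlinN// => e.
    have := k1 x0; have := k2 x0; case/andP: s01 => s0 s1 e2 e1.
    have E1 : f1 x0 = q x0 by nra.
    have E2 : f2 x0 = q x0 by nra.
    split; apply: rlin_le_cone_cut => // _ [t t0 ->] /=.
      by rewrite h1.2 E1.
    by rewrite h2.2 E2.
  have := qmin (Face (cone_cut_sublin hq G0 GD GZ Gq)
    (fun x => le_trans (lqq x) (face_le q x)) cf).
  move=> /(_ (introT (asboolP _) lqq)) /(congr1 (@face_fun p)) /= e.
  move: qN' => /=; rewrite e => le1; apply/eqP; rewrite eq_le le1 /=.
  by have := sublinN x0 hq; lra.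
have lq : rlin q.
  split=> [x y|t x].
    apply/eqP; rewrite eq_le hq.1 /=.
    by have := hq.1 (- x) (- y); rewrite -opprD !qN; lra.
  have [t0|/ltW t0] := leP 0 t; first exact: hq.2.
  have -> : t%:C *: x = - ((- t)%:C *: x) by rewrite rmorphN scaleNr opprK.
  by rewrite qN hq.2 ?oppr_ge0// mulNr opprK.
exists q; split=> //; first exact: face_le.
move=> f1 f2 s h1 h2 l1 l2 s01 e.
have [k1 k2] : (forall x, f1 x <= q x) /\ (forall x, f2 x <= q x).
  by apply: (face_facial h1 h2 l1 l2 s01) => x; rewrite -e.
by split; exact: rlin_le_eq.
Qed.

End Sublinear.

(** * The unitization *)

Local Open Scope cstar_scope.

Section CStarBasics.
Context {R : realType} {A : cstarAlgType R}.
Implicit Types (a b x y : A) (t : R).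

Definition nA a : R := re `|a|.

Lemma nAE a : (nA a)%:C = `|a|.
Proof. by rewrite /nA RRe_real. Qed.
Lemma nA_ge0 a : 0 <= nA a.
Proof. by rewrite -ler0c nAE. Qed.
Lemma nAD a b : nA (a + b) <= nA a + nA b.
Proof. by rewrite -lecR rmorphD /= !nAE ler_normD. Qed.
Lemma nAZ (c : R[i]) a : nA (c *: a) = modc c * nA a.
Proof. by apply: complexI; rewrite rmorphM /= modcE !nAE normrZ. Qed.
Lemma nAN a : nA (- a) = nA a.
Proof. by rewrite /nA normrN. Qed.
Lemma nAB a b : nA (a - b) <= nA a + nA b.
Proof. by rewrite -[nA b]nAN nAD. Qed.
Lemma nABC a b : nA (a - b) = nA (b - a).
Proof. by rewrite /nA distrC. Qed.
Lemma nAM a b : nA (a ** b) <= nA a * nA b.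
Proof. by rewrite -lecR rmorphM /= !nAE cnormM. Qed.
Lemma nA_star_mul a : nA (cstar a ** a) = nA a ^+ 2.
Proof. by apply: complexI; rewrite rmorphXn /= !nAE cnormCstar. Qed.
Lemma nA0 : nA 0 = 0.
Proof. by rewrite /nA normr0. Qed.
Lemma nA_eq0 a : nA a = 0 -> a = 0.
Proof. by move=> h; apply/eqP; rewrite -normr_eq0 -nAE h. Qed.
Lemma nA_star a : nA (cstar a) = nA a.
Proof.
have le y : nA y <= nA (cstar y).
  have := nAM (cstar y) y; rewrite nA_star_mul.
  by have := nA_ge0 y; have := nA_ge0 (cstar y); nra.
by apply/eqP; rewrite eq_le le -{2}[a]cstarK le.
Qed.
Lemma nA_le1 a : (`|a| <= 1) = (nA a <= 1).
Proof. by rewrite -nAE -lecR. Qed.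

Lemma cmul0l a : 0 ** a = 0.
Proof. by apply: (addrI (0 ** a)); rewrite -cmulDl !addr0. Qed.
Lemma cmul0r a : a ** 0 = 0.
Proof. by apply: (addrI (a ** 0)); rewrite -cmulDr !addr0. Qed.
Lemma cmulNl a b : (- a) ** b = - (a ** b).
Proof. by apply: (addrI (a ** b)); rewrite -cmulDl !subrr cmul0l. Qed.
Lemma cmulNr a b : a ** (- b) = - (a ** b).
Proof. by apply: (addrI (a ** b)); rewrite -cmulDr !subrr cmul0r. Qed.
Lemma cmulBl a b x : (a - b) ** x = a ** x - b ** x.
Proof. by rewrite cmulDl cmulNl. Qed.
Lemma cmulBr a b x : x ** (a - b) = x ** a - x ** b.
Proof. by rewrite cmulDr cmulNr. Qed.
Lemma cstar0 : cstar (0 : A) = 0.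
Proof. by apply: (addrI (cstar (0 : A))); rewrite -cstarD !addr0. Qed.
Lemma cstarN a : cstar (- a) = - cstar a.
Proof. by apply: (addrI (cstar a)); rewrite -cstarD !subrr cstar0. Qed.

End CStarBasics.

Lemma cauchy_seq_cvg (K : numFieldType) (T : completeNormedModType K) (u : nat -> T) :
  (forall e : K, 0 < e -> exists n0, forall n, (n0 <= n)%N -> `|u n - u n0| <= e) ->
  exists z, forall e : K, 0 < e ->
    exists n0, forall n, (n0 <= n)%N -> `|u n - z| <= e.
Proof.
move=> h; have /cvg_ex[z /cvgrPdist_le uz] : cvg (u @ \oo).
  apply/cauchy_cvgP/cauchy_exP => e e0.
  have e20 : 0 < e / 2 by rewrite divr_gt0.
  have [n0 hn] := h _ e20; exists (u n0); exists n0 => // n /= /hn le.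
  rewrite -ball_normE /= distrC; apply: le_lt_trans le _.
  by rewrite ltr_pdivrMr// ltr_pMr// ltr1n.
exists z => e /uz[n0 _ hn]; exists n0 => n /hn /=.
by rewrite distrC.
Qed.

Lemma bounded_nondecreasing_cauchy (R : realType) (r : nat -> R) :
  (forall n, r n <= r n.+1) -> (forall n, r n <= 1) ->
  forall e, 0 < e -> exists n0, forall n, (n0 <= n)%N -> r n - r n0 <= e.
Proof.
move=> rS r1 e e0.
have hs : has_sup (range r).
  by split; [exists (r 0%N), 0%N | exists 1 => _ [n _ <-]].
have [_ [n0 _ <-] h] := sup_adherent e0 hs; exists n0 => n _.
have : r n <= sup (range r) by apply: ub_le_sup; [exact: hs.2 | exists n].
by move: h; lra.
Qed.

Lemma dist_telescope (R : realType) (d : nat -> nat -> R) (r : nat -> R) :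
  (forall n, d n n = 0) -> (forall l m n, d n l <= d n m + d m l) ->
  (forall n, d n.+1 n <= r n.+1 - r n) ->
  forall m n, (m <= n)%N -> d n m <= r n - r m.
Proof.
move=> d0 dt dS m; elim=> [|n IH]; first by rewrite leqn0 => /eqP->; rewrite d0 subrr.
rewrite leq_eqVlt => /predU1P[->|]; first by rewrite d0 subrr.
by rewrite ltnS => /IH; have := dt m n n.+1; have := dS n; lra.
Qed.

Definition unitz {R : realType} (A : cstarAlgType R) : Type := (A * R[i]^o)%type.

Section Unitization.
Context {R : realType} (A : cstarAlgType R).
Local Notation U := (unitz A).
HB.instance Definition _ := GRing.Lmodule.copy U (A * R[i]^o)%type.

Implicit Types (x y z : U).

Definition uone : U := (0, 1).
Definition umul x y : U :=
  (x.1 ** y.1 + x.2 *: y.1 + y.2 *: x.1, x.2 * y.2).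
Definition ustar x : U := (cstar x.1, conjc x.2).

Lemma umulA : associative umul.
Proof.
move=> [a s] [b t] [c u]; rewrite /umul /=; congr (_, _); last exact: mulrA.
rewrite !(cmulDl, cmulDr, cmulZl, cmulZr, scalerDr, scalerA, cmulA).
rewrite !addrA [RHS](ACl (1*3*5*2*4*6*7)) /=.
by congr (_ + _ + _ *: _ + _ *: _); exact: mulrC.
Qed.

Lemma umul1l : left_id uone umul.
Proof.
by move=> [a s]; rewrite /umul /= cmul0l scale1r scaler0 add0r addr0 mul1r.
Qed.
Lemma umul1r : right_id uone umul.
Proof.
by move=> [a s]; rewrite /umul /= cmul0r scale1r scaler0 !add0r mulr1.
Qed.
Lemma umulDl : left_distributive umul +%R.
Proof.
move=> [a s] [b t] [c u]; rewrite /umul /=; congr (_, _); last exact: mulrDl.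
by rewrite cmulDl scalerDl scalerDr !addrA (ACl (1*3*5*2*4*6)).
Qed.
Lemma umulDr : right_distributive umul +%R.
Proof.
move=> [a s] [b t] [c u]; rewrite /umul /=; congr (_, _); last exact: mulrDr.
by rewrite cmulDr scalerDl scalerDr !addrA (ACl (1*3*5*2*4*6)).
Qed.
Lemma uone_neq0 : uone != 0.
Proof. by apply/eqP => /(congr1 snd) /eqP; rewrite oner_eq0. Qed.

HB.instance Definition _ := GRing.Zmodule_isNzRing.Build U
  umulA umul1l umul1r umulDl umulDr uone_neq0.

Lemma uscalerAl (c : R[i]) x y : c *: (x * y) = (c *: x) * y.
Proof.
move: x y => [a s] [b t]; congr (_, _); last exact: mulrA.
by rewrite /= !scalerDr cmulZl !scalerA (mulrC c t).
Qed.
HB.instance Definition _ := GRing.Lmodule_isLalgebra.Build R[i] U uscalerAl.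

Lemma uscalerAr (c : R[i]) x y : c *: (x * y) = x * (c *: y).
Proof.
move: x y => [a s] [b t]; congr (_, _); last by rewrite /= mulrCA.
by rewrite /= !scalerDr cmulZr !scalerA (mulrC c s).
Qed.
HB.instance Definition _ := GRing.Lalgebra_isAlgebra.Build R[i] U uscalerAr.

Definition umulv x (y : A) : A := x.1 ** y + x.2 *: y.

(* The maximum of the operator norm on [A] and of the modulus of the scalar
   part: a C*-norm even if [A] has a unit. *)
Definition ubnd x := [set r : R | [/\ 0 <= r, modc x.2 <= r &
  forall a, nA (umulv x a) <= r * nA a]].
Definition unm x := inf (ubnd x).

Lemma ubnd_has_inf x : has_inf (ubnd x).
Proof.
split; last by exists 0 => r [].
exists (nA x.1 + modc x.2); split.
- by rewrite addr_ge0 ?nA_ge0 ?modc_ge0.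
- by rewrite lerDr nA_ge0.
move=> y; apply: le_trans (nAD _ _) _; rewrite mulrDl nAZ lerD2r; exact: nAM.
Qed.

Lemma unm_le x r : 0 <= r -> modc x.2 <= r ->
  (forall a, nA (umulv x a) <= r * nA a) -> unm x <= r.
Proof. by move=> r0 xr h; apply: ge_inf; first exact: (ubnd_has_inf x).2. Qed.

Lemma le_unm x t : (forall r, ubnd x r -> t <= r) -> t <= unm x.
Proof. by move=> h; apply: lb_le_inf => //; exact: (ubnd_has_inf x).1. Qed.

Lemma unm_ge0 x : 0 <= unm x.
Proof. by apply: le_unm => r []. Qed.
Lemma modc_unm x : modc x.2 <= unm x.
Proof. by apply: le_unm => r []. Qed.
Lemma unmP x a : nA (umulv x a) <= unm x * nA a.
Proof.
have := nA_ge0 a; rewrite le_eqVlt => /predU1P[a0|a0].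
  by rewrite -a0 mulr0 (nA_eq0 (esym a0)) /umulv cmul0r scaler0 addr0 nA0.
rewrite -ler_pdivrMr//; apply: le_unm => r [_ _ /(_ a)].
by rewrite ler_pdivrMr.
Qed.
Lemma unm_le_sum x : unm x <= nA x.1 + modc x.2.
Proof.
apply: unm_le.
- by rewrite addr_ge0 ?nA_ge0 ?modc_ge0.
- by rewrite lerDr nA_ge0.
move=> y; apply: le_trans (nAD _ _) _; rewrite mulrDl nAZ lerD2r; exact: nAM.
Qed.

Lemma umulvD x y a : umulv (x + y) a = umulv x a + umulv y a.
Proof. by rewrite /umulv /= cmulDl scalerDl !addrA (ACl (1*3*2*4)). Qed.
Lemma umulvZ (c : R[i]) x a : umulv (c *: x) a = c *: umulv x a.
Proof. by rewrite /umulv /= cmulZl scalerDr scalerA. Qed.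
Lemma umulvM x y a : umulv (x * y) a = umulv x (umulv y a).
Proof.
rewrite /umulv /= !(cmulDl, cmulDr, cmulZl, cmulZr, scalerDr, scalerA, cmulA).
by rewrite !addrA (ACl (1*3*2*4)).
Qed.

(** The C*-identity of [A] turns the left side into the norm of [a^* (x^* x a)]. This is what gives
    the unitization its C*-identity. *)
Lemma nA_umulv_sqr x a :
  nA (umulv x a) ^+ 2 <= nA (umulv (ustar x * x) a) * nA a.
Proof.
rewrite umulvM -nA_star_mul.
have -> : cstar (umulv x a) ** umulv x a = cstar a ** umulv (ustar x) (umulv x a).
  rewrite /umulv /= cstarD cstarM cstarZ.
  by rewrite !(cmulDl, cmulDr, cmulZl, cmulZr, cmulA, scalerDr) !addrA.
by apply: le_trans (nAM _ _) _; rewrite nA_star mulrC.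
Qed.

Lemma ustarK : involutive ustar.
Proof. by move=> [a s]; rewrite /ustar /= cstarK conjcK. Qed.
Lemma ustarD : {morph ustar : x y / x + y}.
Proof. by move=> x y; rewrite /ustar /= cstarD rmorphD. Qed.
Lemma ustarM x y : ustar (x * y) = ustar y * ustar x.
Proof.
move: x y => [a s] [b t]; rewrite /ustar /=; congr (_, _); last first.
  by rewrite rmorphM mulrC.
by rewrite /= !cstarD cstarM !cstarZ [LHS](ACl (1*3*2)).
Qed.
Lemma ustarZ (c : R[i]) x : ustar (c *: x) = conjc c *: ustar x.
Proof. by rewrite /ustar /= cstarZ rmorphM. Qed.

Lemma unmD x y : unm (x + y) <= unm x + unm y.
Proof.
apply: unm_le.
- by rewrite addr_ge0 ?unm_ge0.
- by apply: le_trans (modcD _ _) _; rewrite lerD ?modc_unm.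
by move=> a; rewrite umulvD mulrDl; apply: le_trans (nAD _ _) _; rewrite lerD ?unmP.
Qed.
Lemma unmM x y : unm (x * y) <= unm x * unm y.
Proof.
apply: unm_le.
- by rewrite mulr_ge0 ?unm_ge0.
- by rewrite modcM ler_pM ?modc_unm ?modc_ge0.
move=> a; rewrite umulvM; apply: le_trans (unmP _ _) _.
by rewrite -mulrA ler_wpM2l ?unm_ge0 ?unmP.
Qed.
Lemma unmZ (c : R[i]) x : unm (c *: x) = modc c * unm x.
Proof.
have le (d : R[i]) y : unm (d *: y) <= modc d * unm y.
  apply: unm_le.
  - by rewrite mulr_ge0 ?unm_ge0 ?modc_ge0.
  - by rewrite modcM ler_wpM2l ?modc_ge0 ?modc_unm.
  by move=> a; rewrite umulvZ nAZ -mulrA ler_wpM2l ?modc_ge0 ?unmP.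
apply/eqP; rewrite eq_le le /=.
have [->|c0] := eqVneq c 0.
  by rewrite (_ : modc 0 = 0) ?mul0r ?unm_ge0// (modcR 0) normr0.
have m0 : 0 < modc c.
  by rewrite lt_neqAle modc_ge0 andbT; apply: contra_neq c0 => /esym/modc0_eq0.
rewrite mulrC -ler_pdivlMr// mulrC.
have := le c^-1 (c *: x); rewrite scalerA mulVf// scale1r.
have -> // : modc c^-1 = (modc c)^-1.
apply: (mulfI (lt0r_neq0 m0)); rewrite -modcM divff// divff ?lt0r_neq0//.
by rewrite (modcR 1) normr1.
Qed.

Lemma unm_sqr_le x : unm x ^+ 2 <= unm (ustar x * x).
Proof.
rewrite -[leRHS]sqr_sqrtr ?unm_ge0// ler_sqr ?nnegrE ?unm_ge0 ?sqrtr_ge0//.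
apply: unm_le; first exact: sqrtr_ge0.
  rewrite -ler_sqr ?nnegrE ?modc_ge0 ?sqrtr_ge0// sqr_sqrtr ?unm_ge0//.
  apply: le_trans (modc_unm _); rewrite modcM modcJ expr2 //.
move=> a; rewrite -ler_sqr ?nnegrE ?mulr_ge0 ?nA_ge0 ?sqrtr_ge0//.
rewrite exprMn sqr_sqrtr ?unm_ge0//; apply: le_trans (nA_umulv_sqr _ _) _.
by rewrite expr2 mulrA ler_wpM2r ?nA_ge0 ?unmP.
Qed.

Lemma unm_star_mul x : unm (ustar x * x) = unm x ^+ 2.
Proof.
have le y : unm y <= unm (ustar y).
  have := le_trans (unm_sqr_le y) (unmM _ _).
  by have := unm_ge0 y; have := unm_ge0 (ustar y); nra.
apply/eqP; rewrite eq_le unm_sqr_le andbT expr2.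
apply: le_trans (unmM _ _) _; rewrite ler_wpM2r ?unm_ge0//.
by rewrite -{2}[x]ustarK le.
Qed.

(** Testing on [a^*], where [x = (a, s)]: [a a^* = x a^* - s a^*], and each of the two terms costs
    one [unm x]. Together with [modc_unm] and [unm_le_sum], [unm] is equivalent to the sum norm,
    from which completeness follows. *)
Lemma nA_le_unm x : nA x.1 <= 2 * unm x.
Proof.
have h : nA x.1 ^+ 2 <= 2 * unm x * nA x.1.
  rewrite -nA_star -nA_star_mul cstarK.
  have -> : x.1 ** cstar x.1 = umulv x (cstar x.1) - x.2 *: cstar x.1.
    by rewrite addrK.
  apply: le_trans (nAB _ _) _; have := unmP x (cstar x.1); rewrite nAZ nA_star.
  by have := modc_unm x; have := nA_ge0 x.1; nra.
by have := nA_ge0 x.1; have := unm_ge0 x; nra.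
Qed.

Lemma unm_eq0 x : unm x = 0 -> x = 0.
Proof.
move=> x0; have := nA_le_unm x; have := modc_unm x; rewrite x0 mulr0 => h2 h1.
case: x {x0} h1 h2 => [a s] /= h1 h2; congr (_, _).
  by apply: nA_eq0; apply/eqP; rewrite eq_le h1 nA_ge0.
by apply: modc0_eq0; apply/eqP; rewrite eq_le h2 modc_ge0.
Qed.

Lemma usndB x y : (x - y).2 = x.2 - y.2. Proof. by []. Qed.

Lemma unm_complete (u : nat -> U) (r : nat -> R) :
  (forall n, unm (u n.+1 - u n) <= r n.+1 - r n) -> (forall n, r n <= 1) ->
  exists z : U, forall eps : R, 0 < eps ->
    exists n0, forall n, (n0 <= n)%N -> unm (u n - z) <= eps.
Proof.
move=> ur r1.
have rS n : r n <= r n.+1 by rewrite -subr_ge0; apply: le_trans (ur n); exact: unm_ge0.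
have dist := @dist_telescope R (fun n m => unm (u n - u m)) r.
have {}dist m n : (m <= n)%N -> unm (u n - u m) <= r n - r m.
  apply: dist => // [k|l k p].
    rewrite subrr; apply/eqP; rewrite eq_le unm_ge0 andbT.
    by apply: le_trans (unm_le_sum _) _; rewrite /= nA0 (modcR 0) normr0 addr0.
  by rewrite -(subrKA (u k)) unmD.
have cau (T : completeNormedModType R) (v : nat -> T) :
    (forall n m, `|v n - v m| <= 2 * unm (u n - u m)) ->
    exists l : T, forall e : R, 0 < e ->
      exists n0, forall n, (n0 <= n)%N -> `|v n - l| <= e.
  move=> h; apply: cauchy_seq_cvg => e e0.
  have [|n0 hn] := bounded_nondecreasing_cauchy rS r1 (e := e / 2); first lra.
  by exists n0 => n nn; have := h n n0; have := hn _ nn; have := dist _ _ nn; lra.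
have Re_cau n m : `|re (u n).2 - re (u m).2| <= 2 * unm (u n - u m).
  have := modc_unm (u n - u m); rewrite usndB.
  have := unm_ge0 (u n - u m).
  have : `|re ((u n).2 - (u m).2)| <= modc ((u n).2 - (u m).2).
    by rewrite -lecR modcE normc_ge_Re.
  by rewrite raddfB /=; lra.
have Im_cau n m : `|im (u n).2 - im (u m).2| <= 2 * unm (u n - u m).
  have := modc_unm (u n - u m); rewrite usndB.
  have := unm_ge0 (u n - u m).
  have : `|im ((u n).2 - (u m).2)| <= modc ((u n).2 - (u m).2).
    rewrite -ler_sqr ?nnegrE ?modc_ge0// modc_sqr -normrX ger0_norm ?sqr_ge0//.
    by rewrite lerDr sqr_ge0.
  by rewrite raddfB /=; lra.
have [s1 h1] := cau R _ Re_cau; have [s2 h2] := cau R _ Im_cau.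
have [a h] : exists a : A, forall e : R[i], 0 < e ->
    exists n0, forall n, (n0 <= n)%N -> `|(u n).1 - a| <= e.
  apply: cauchy_seq_cvg => e e0.
  have eE : e = (re e)%:C by rewrite RRe_real// gtr0_real.
  move: e0; rewrite eE ltcR => e0.
  have [|n0 hn] := bounded_nondecreasing_cauchy rS r1 (e := re e / 2); first lra.
  exists n0 => n nn; rewrite -nAE lecR; have := nA_le_unm (u n - u n0).
  by have := hn _ nn; have := dist _ _ nn; rewrite /=; lra.
exists (a, s1 +i* s2) => e e0; have e30 : 0 < e / 3 by lra.
have /h[n0 k0] : 0 < (e / 3)%:C by rewrite ltcR.
have [n1 k1] := h1 _ e30; have [n2 k2] := h2 _ e30.
exists (maxn n0 (maxn n1 n2)) => n; rewrite !geq_max => /and3P[/k0 j0 /k1 j1 /k2 j2].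
apply: le_trans (unm_le_sum _) _ => /=.
move: j0; rewrite -nAE lecR => j0.
suff : modc ((u n).2 - (s1 +i* s2)) <=
  `|re (u n).2 - s1| + `|im (u n).2 - s2| by lra.
case: (u n).2 => v w /=.
have -> : (v +i* w) - (s1 +i* s2) = (v - s1)%:C + 'i * (w - s2)%:C by simpc.
apply: le_trans (modcD _ _) _; rewrite modcM !modcR.
suff -> : modc 'i = 1 :> R by rewrite mul1r.
by apply/eqP; rewrite -sqrp_eq1 ?modc_ge0// modc_sqr /= expr0n expr1n add0r.
Qed.

HB.instance Definition _ := isUnitalCStar.Build R U ustarK ustarD ustarM ustarZ
  unmD unmZ unmM unm_star_mul unm_eq0 unm_complete.

End Unitization.

(** * States *)

Section ComplexParts.
Context {R : realType}.
Implicit Types z w c : R[i].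
Lemma reD z w : re (z + w) = re z + re w. Proof. by case: z w => [? ?] []. Qed.
Lemma imD z w : im (z + w) = im z + im w. Proof. by case: z w => [? ?] []. Qed.
Lemma reN z : re (- z) = - re z. Proof. by case: z. Qed.
Lemma reM z w : re (z * w) = re z * re w - im z * im w.
Proof. by case: z w => [? ?] []. Qed.
Lemma imM z w : im (z * w) = re z * im w + im z * re w.
Proof. by case: z w => [a b] [c d] /=; rewrite addrC. Qed.
Lemma reJ z : re (conjc z) = re z. Proof. by case: z. Qed.
Lemma imJ z : im (conjc z) = - im z. Proof. by case: z. Qed.
Lemma complexP z w : re z = re w -> im z = im w -> z = w.
Proof. by case: z w => [? ?] [? ?] /= -> ->. Qed.
Lemma ge0P z : 0 <= z -> 0 <= re z /\ im z = 0.
Proof. by rewrite lecE /= => /andP[/eqP -> ->]. Qed.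

(** The values at [c = 1] and [c = i] force [s'] to be the conjugate of [s]. The Cauchy-Schwarz
    bound then comes from [c = - t s] with [t] real. *)
Lemma quadratic_form_cs (px py s s' : R[i]) : 0 <= py ->
  (forall c, 0 <= px + c * s' + conjc c * s + c * conjc c * py) ->
  s' = conjc s /\ modc s ^+ 2 <= re px * re py.
Proof.
move=> /ge0P[py0 pyi] h; have [p0 pi] := ge0P (h 0).
have [_ h1] := ge0P (h 1); have [_ h3] := ge0P (h 'i%C).
move: p0 pi h1 h3.
rewrite !(reD, imD, reM, imM, reN, reJ, imJ) /= pyi => p0 pi h1 h3.
have e1 : im s' = - im s by lra.
have e2 : re s' = re s by lra.
split; first by apply: complexP; rewrite ?reJ ?imJ.
rewrite modc_sqr; set n := re s ^+ 2 + im s ^+ 2.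
have key t : 0 <= re px - 2 * t * n + t ^+ 2 * n * re py.
  have [+ _] := ge0P (h (- t%:C * s)).
  rewrite !(reD, imD, reM, imM, reN, reJ, imJ) /= e1 e2 pyi => k.
  by apply: le_trans k _; rewrite /n; lra.
have n0 : 0 <= n by rewrite addr_ge0 ?sqr_ge0.
have px0 : 0 <= re px by have := key 0; lra.
move: py0; rewrite le_eqVlt => /predU1P[p0'|p0'].
  rewrite -p0' mulr0 leNgt; apply/negP => npos.
  (* When [py = 0] the form is affine in [t]; this [t] gives it the value [- px - 2 < 0]. *)
  have := key ((re px + 1) / n); rewrite -p0' mulr0 addr0.
  by rewrite -!mulrA mulVf ?gt_eqF// mulr1; lra.
(* The minimizing [t]. *)
have := key (re py)^-1; rewrite expr2 -!mulrA [n * re py]mulrC mulKf ?gt_eqF//.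
move=> k; rewrite -ler_pdivrMr//; lra.
Qed.
End ComplexParts.

Section States.
Context {R : realType} {A : cstarAlgType R}.
Local Notation C := R[i].
Implicit Types (a b x y : A) (phi psi : A -> C).

Lemma functionalD phi a b : scalar phi -> phi (a + b) = phi a + phi b.
Proof. by move=> h; have := h 1 a b; rewrite scale1r mul1r. Qed.
Lemma functional0 phi : scalar phi -> phi 0 = 0.
Proof. by move=> h; apply: (addrI (phi 0)); rewrite -functionalD// !addr0. Qed.
Lemma functionalZ phi (c : C) a : scalar phi -> phi (c *: a) = c * phi a.
Proof. by move=> h; have := h c a 0; rewrite !addr0 functional0// addr0. Qed.
Lemma functionalN phi a : scalar phi -> phi (- a) = - phi a.
Proof. by move=> h; rewrite -scaleN1r functionalZ// mulN1r. Qed.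
Lemma functionalB phi a b : scalar phi -> phi (a - b) = phi a - phi b.
Proof. by move=> h; rewrite functionalD// functionalN. Qed.

Definition contractive phi := forall a, modc (phi a) <= nA a.

Lemma functional_norm1P phi : scalar phi ->
  functional_norm phi = 1 <-> contractive phi /\
    (forall e, 0 < e -> exists2 a, nA a <= 1 & 1 - e < modc (phi a)).
Proof.
move=> lphi; rewrite /functional_norm; set S := [set _ | _ in _].
have S0 : S 0.
  by exists 0; [rewrite /= normr0 | rewrite functional0// normr0].
split=> [h|[le1 ge1]]; last first.
  have ubS : ubound S 1.
    by move=> _ [a /= + <-]; rewrite nA_le1; exact: le_trans (le1 a).
  apply/eqP; rewrite eq_le; apply/andP; split; first by apply: ge_sup => //; exists 0.
  apply/ler_addgt0Pl => e /ge1[a a1 he]; rewrite -lerBlDl; apply/ltW.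
  apply: (lt_le_trans he); apply: ub_le_sup; first by exists 1.
  by exists a => //=; rewrite nA_le1.
have hs : has_sup S.
  by apply: contrapT => /sup_out; rewrite h => /eqP; rewrite oner_eq0.
split=> [a|e e0].
  have := nA_ge0 a; rewrite le_eqVlt => /predU1P[a0|a0].
    by rewrite -a0 (nA_eq0 (esym a0)) functional0// (modcR 0) normr0.
  have : modc (phi ((nA a)^-1%:C *: a)) <= 1.
    rewrite -h; apply: ub_le_sup; first exact: hs.2.
    exists ((nA a)^-1%:C *: a) => //=.
    by rewrite nA_le1 nAZ modcR gtr0_norm ?invr_gt0// mulVf ?gt_eqF.
  rewrite functionalZ// modcM modcR gtr0_norm ?invr_gt0// mulrC.
  by rewrite ler_pdivrMr// mul1r.
have [_ [a /= + <-]] := sup_adherent e0 hs; rewrite nA_le1 h => a1 he.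
by exists a.
Qed.

(* As the members [u] are self-adjoint, multiplication on one side suffices. *)
Definition approx_unital (E : set A) := forall a e, 0 < e ->
  exists u, [/\ E u, cstar u = u, nA u <= 1 & nA (u ** a - a) <= e].

Variables (E : set A) (au : approx_unital E).

Lemma approx_unitalr a e : 0 < e ->
  exists u, [/\ E u, cstar u = u, nA u <= 1 & nA (a ** u - a) <= e].
Proof.
move=> /(au (cstar a))[u [Eu us u1 h]]; exists u; split=> //.
by rewrite -nA_star cstarD cstarN cstarM us.
Qed.

Section PositiveFunctional.
Variables (phi : A -> C) (lphi : scalar phi).
Hypotheses (phi_ge0 : forall a, 0 <= phi (cstar a ** a)) (phi1 : contractive phi).

Lemma positive_cs x y :
  phi (cstar x ** y) = conjc (phi (cstar y ** x)) /\
  modc (phi (cstar y ** x)) ^+ 2 <= re (phi (cstar x ** x)) * re (phi (cstar y ** y)).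
Proof.
apply: quadratic_form_cs => // c; have := phi_ge0 (x + c *: y).
rewrite cstarD cstarZ !(cmulDl, cmulDr, cmulZl, cmulZr) !(functionalD, functionalZ)//.
by rewrite !addrA mulrA [conjc c * c]mulrC.
Qed.

Lemma contractiveB a b : modc (phi a - phi b) <= nA (a - b).
Proof. by rewrite -functionalB. Qed.

(** Cauchy-Schwarz yields [phi (a^* u) = conj (phi (u a))]; [u] then runs along the approximate
    unit, which stands in for the missing 1. *)
Lemma state_star a : phi (cstar a) = conjc (phi a).
Proof.
apply/eqP; rewrite -subr_eq0; apply/eqP/modc0_eq0/eqP.
rewrite eq_le modc_ge0 andbT; apply/ler_addgt0Pl => e e0; rewrite addr0.
have e20 : 0 < e / 2 by lra.
have [u [_ us u1 h]] := au a e20.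
have [+ _] := positive_cs a u; rewrite us => hu.
have -> : phi (cstar a) - conjc (phi a) =
  (phi (cstar a) - phi (cstar a ** u)) + conjc (phi (u ** a) - phi a).
  by rewrite rmorphB /= hu addrA subrK.
apply: le_trans (modcD _ _) _; rewrite modcJ.
have := contractiveB (u ** a) a; have := contractiveB (cstar a) (cstar a ** u).
have -> : nA (cstar a - cstar a ** u) = nA (u ** a - a).
  by rewrite nABC -nA_star cstarD cstarN cstarM cstarK us.
by lra.
Qed.

(** Cauchy-Schwarz bounds [|phi (u a)|^2] by [phi (a^* a) phi (u^2)], where [phi (u^2) <= 1], and
    [u a] tends to [a]. *)
Lemma state_sqr_le a : modc (phi a) ^+ 2 <= re (phi (cstar a ** a)).
Proof.
set q := re _.
have q0 : 0 <= q by have [] := ge0P (phi_ge0 a).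
rewrite -[leRHS]sqr_sqrtr// ler_sqr ?nnegrE ?modc_ge0 ?sqrtr_ge0//.
apply/ler_addgt0Pl => e e0; have [u [_ us u1 h]] := au a e0.
have -> : phi a = (phi a - phi (u ** a)) + phi (u ** a) by rewrite subrK.
apply: le_trans (modcD _ _) _; apply: lerD.
  by apply: le_trans (contractiveB _ _) _; rewrite nABC.
rewrite -ler_sqr ?nnegrE ?modc_ge0 ?sqrtr_ge0// sqr_sqrtr//.
have [_] := positive_cs a u; rewrite us => /le_trans; apply.
rewrite -/q ler_piMr//; apply: le_trans (Re_le_modc _) _.
apply: le_trans (phi1 _) _; apply: le_trans (nAM _ _) _.
by have := nA_ge0 u; nra.
Qed.

(** Vanishing on [L] need only be tested on the self-adjoint elements [l^* l], which is what lying
    below [umaj] controls directly. *)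
Lemma state_null (L : set A) :
  (forall l, L l -> re (phi (cstar l ** l)) = 0) -> vanishing_on L phi.
Proof.
move=> h l Ll; apply: modc0_eq0; have := state_sqr_le l; rewrite h//.
by have := modc_ge0 (phi l); nra.
Qed.

(** Both [x] and [y] are taken in the approximate unit, so that [x a y] approaches [a]. *)
Lemma kernel_null a : (forall x y, phi (x ** a ** y) = 0) -> phi a = 0.
Proof.
move=> h; apply/modc0_eq0/eqP; rewrite eq_le modc_ge0 andbT.
apply/ler_addgt0Pl => e e0; rewrite addr0; have e20 : 0 < e / 2 by lra.
have [u [_ us u1 hu]] := approx_unitalr a e20.
have [v [_ vs v1 hv]] := au (a ** u) e20.
have -> : phi a = (phi a - phi (a ** u)) + (phi (a ** u) - phi (v ** (a ** u))).
  by rewrite [v ** _]cmulA h subr0 subrK.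
apply: le_trans (modcD _ _) _.
have := contractiveB a (a ** u); have := contractiveB (a ** u) (v ** (a ** u)).
by rewrite nABC (nABC a); lra.
Qed.

End PositiveFunctional.

Lemma stateP phi : states A phi ->
  [/\ scalar phi, (forall a, 0 <= phi (cstar a ** a)) & contractive phi].
Proof. by move=> [[l p] /(functional_norm1P l)[]]. Qed.

End States.

(** * The majorant attached to an ideal *)

Section Ideals.
Context {R : realType} {A : cstarAlgType R}.
Local Notation C := R[i].
Local Notation U := (unitz A).
Implicit Types (a b l : A) (x y : U) (t s : R) (f : U -> R) (psi : A -> C).

Lemma closed_approx (L : set A) a : closed L ->
  (forall e, 0 < e -> exists2 l, L l & nA (a - l) <= e) -> L a.
Proof.
move=> /closure_id cL h; rewrite cL => B /nbhs_ballP[e e0 aeB].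
have eE : e = (re e)%:C by rewrite RRe_real// gtr0_real.
have e20 : 0 < re e / 2 by move: e0; rewrite /= eE ltcR => ?; lra.
have [l Ll le] := h _ e20; exists l; split => //; apply: aeB.
rewrite -ball_normE /= eE -nAE ltcR; lra.
Qed.

Definition emb a : U := (a, 0).
Lemma embD a b : emb (a + b) = emb a + emb b.
Proof. by rewrite /emb; congr (_, _); rewrite addr0. Qed.
Lemma embN a : emb (- a) = - emb a.
Proof. by rewrite /emb; congr (_, _); rewrite oppr0. Qed.
Lemma embZ (c : C) a : emb (c *: a) = c *: emb a.
Proof. by rewrite /emb; congr (_, _); exact/esym/mulr0. Qed.
Lemma embM a b : emb (a ** b) = emb a * emb b.
Proof.
by rewrite /emb; congr (_, _); rewrite /= ?mulr0// !scale0r !addr0.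
Qed.
Lemma emb_star a : ust (emb a) = emb (cstar a).
Proof. by rewrite /emb; congr (_, _); rewrite /= oppr0. Qed.
Lemma nm_emb a : nm (emb a) <= nA a.
Proof. by apply: le_trans (unm_le_sum _) _; rewrite /= (modcR 0) normr0 addr0. Qed.

Lemma ufst_rs t : (rs t : U).1 = 0. Proof. by rewrite /= scaler0. Qed.
Lemma usnd_rs t : (rs t : U).2 = t%:C. Proof. exact: mulr1. Qed.

Variables (L : set A) (Lid : closed_ideal L).

Lemma cidealD a b : L a -> L b -> L (a + b).
Proof. by case: Lid => _ _ h _ La; rewrite -[a]scale1r; exact: h. Qed.
Lemma cidealZ (c : C) a : L a -> L (c *: a).
Proof. by case: Lid => _ L0 h _ La; rewrite -[_ *: _]addr0; exact: h. Qed.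
Lemma cidealN a : L a -> L (- a).
Proof. by rewrite -scaleN1r; exact: cidealZ. Qed.
Lemma cidealMl a b : L b -> L (a ** b). Proof. by case: Lid => _ _ _ h /(h a)[]. Qed.
Lemma cidealMr a b : L b -> L (b ** a). Proof. by case: Lid => _ _ _ h /(h a)[]. Qed.

Definition unitz_ideal : set U := [set x | x.2 = 0 /\ L x.1].

Lemma unitz_idealP : uideal unitz_ideal.
Proof.
have [Lc L0 _ _] := Lid; split.
- by split.
- move=> [a s] [b t] [/= -> La] [/= -> Lb]; split=> /=; first by rewrite subrr.
  by apply: cidealD => //; exact: cidealN.
- move=> [a s] [b t] [/= -> Lb]; split; split; rewrite /= ?mulr0 ?mul0r//.
    rewrite scale0r addr0; apply: cidealD; first exact: cidealMl.
    exact: cidealZ.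
  rewrite scale0r addr0; apply: cidealD; first exact: cidealMr.
  exact: cidealZ.
move=> u z uL uz; split.
  apply/modc0_eq0/eqP; rewrite eq_le modc_ge0 andbT.
  apply/ler_addgt0Pl => e e0; rewrite addr0; have [n /(_ _ (leqnn _)) h] := uz e e0.
  apply: le_trans h; apply: le_trans (modc_unm _).
  by rewrite usndB (uL n).1 sub0r modcN.
apply: closed_approx => // e e0; have e20 : 0 < e / 2 by lra.
have [n /(_ _ (leqnn _)) h] := uz _ e20; exists (u n).1; first exact: (uL n).2.
rewrite nABC; have := nA_le_unm (u n - z) => /= k; apply: le_trans k _.
by move: h; rewrite /nm /=; lra.
Qed.

Local Notation I := unitz_ideal.

Definition hpart x : U := rs 2^-1 * (x + ust x).
Lemma hpart_sa x : ust (hpart x) = hpart x.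
Proof. by rewrite /hpart ustM ust_rs ustD ustK -rsC addrC. Qed.
Lemma hpart_id x : ust x = x -> hpart x = x.
Proof.
move=> xs; rewrite /hpart xs.
have -> : x + x = rs 2 * x by rewrite (rsD 1 1) rs1 mulrDl mul1r.
by rewrite mulrA -rsM mulVf ?pnatr_eq0// rs1 mul1r.
Qed.
Lemma hpartD x y : hpart (x + y) = hpart x + hpart y.
Proof. by rewrite /hpart ustD -mulrDr addrACA. Qed.
Lemma hpartZ t x : hpart (t%:C *: x) = rs t * hpart x.
Proof.
by rewrite /hpart ustZ conjc_real -scalerDr -!rsZ !mulrA -!rsM mulrC.
Qed.
Lemma hpart_skew x : ust x = - x -> hpart x = 0.
Proof. by move=> xs; rewrite /hpart xs subrr mulr0. Qed.
Lemma nm_hpart x : nm (hpart x) <= nm x.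
Proof.
rewrite /hpart nm_rs ger0_norm ?invr_ge0//.
by have := nmD x (ust x); rewrite nm_ust; lra.
Qed.
Lemma usnd_hpart x : (hpart x).2 = (re x.2)%:C.
Proof.
have -> : (hpart x).2 = (rs 2^-1 : U).2 * (x.2 + conjc x.2) by [].
by rewrite usnd_rs; apply: complexP; rewrite !(reD, imD, reM, imM, reJ, imJ) /=; field.
Qed.

Lemma pos_usnd y : pos y -> 0 <= re y.2.
Proof.
move=> /pos_root[[w s] [/pos_sa /(congr1 snd) /= ws <- _]] /=.
case: s ws => [s s'] [e] /=.
have -> : s' = 0 by lra.
by rewrite mulr0 subr0 -expr2 sqr_ge0.
Qed.

(* [umaj x] is the top of the numerical range of the image of [x] in the
   quotient of the unitization by [L]. *)
Definition upper x : set R :=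
  [set t | exists l : U, [/\ I l, ust l = l & pos (rs t - hpart x - l)]].
Definition umaj x : R := inf (upper x).

(** The scalar part is a character of the unitization that kills [L]. It bounds the set from below,
    so the infimum in [umaj] is a genuine one. *)
Lemma upper_ge x t : upper x t -> re x.2 <= t.
Proof.
move=> [l [[l2 _] _ /pos_usnd]].
rewrite usndB l2 subr0 usndB usnd_hpart usnd_rs reD reN /=; lra.
Qed.
Lemma upper_nm x : upper x (nm x).
Proof.
exists 0; split; [by case: unitz_idealP | exact: ust0 |].
rewrite subr0; apply: pos_nm_sub; [exact: hpart_sa | exact: nm_hpart].
Qed.
Lemma upper_has_inf x : has_inf (upper x).
Proof. by split; [exists (nm x); exact: upper_nm | exists (re x.2) => t /upper_ge]. Qed.
Lemma umaj_le x t : upper x t -> umaj x <= t.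
Proof. by apply: ge_inf; exact: (upper_has_inf x).2. Qed.
Lemma le_umaj x s : (forall t, upper x t -> s <= t) -> s <= umaj x.
Proof. by move=> h; apply: lb_le_inf => //; exact: (upper_has_inf x).1. Qed.

Lemma upperD x y t s : upper x t -> upper y s -> upper (x + y) (t + s).
Proof.
move=> [l [Il ls pl]] [k [Ik ks pk]]; exists (l + k); split.
- exact: uidealD unitz_idealP _ _ Il Ik.
- by rewrite ustD ls ks.
have -> : rs (t + s) - hpart (x + y) - (l + k) =
  (rs t - hpart x - l) + (rs s - hpart y - k) by rewrite hpartD rsD; ncring.
exact: posD.
Qed.

Lemma upperZ x t s : 0 <= s -> upper x t -> upper (s%:C *: x) (s * t).
Proof.
move=> s0 [l [Il ls pl]]; exists (rs s * l); split.
- exact: uidealMl unitz_idealP _ _ Il.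
- by rewrite ustM ust_rs ls rsC.
by rewrite hpartZ rsM -!mulrBr; exact: posZ.
Qed.

Lemma umaj_sublin : sublin umaj.
Proof.
split=> [x y|t x].
  rewrite -lerBlDr; apply: le_umaj => t ht; rewrite lerBlDr -lerBlDl.
  by apply: le_umaj => s hs; rewrite lerBlDl; apply/umaj_le/upperD.
have le s y : 0 < s -> umaj (s%:C *: y) <= s * umaj y.
  move=> s0; rewrite -ler_pdivrMl//; apply: le_umaj => u hu.
  by rewrite ler_pdivrMl//; apply/umaj_le/upperZ => //; exact: ltW.
rewrite le_eqVlt => /predU1P[<-|t0].
  rewrite scale0r mul0r; apply/eqP; rewrite eq_le; apply/andP; split.
    by apply: umaj_le; rewrite -[X in upper _ X](@nm0 R U); exact: upper_nm.
  by apply: le_umaj => s /upper_ge.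
apply/eqP; rewrite eq_le le//= -ler_pdivlMl//.
have ti : 0 < t^-1 by rewrite invr_gt0.
apply: le_trans (le _ _ ti); rewrite scalerA -rmorphM mulVf ?gt_eqF//.
by rewrite scale1r.
Qed.

(** If the numerical range of [h] modulo [L] is at most 0 on both sides, then [e - h] and [e + h]
    are positive modulo [L] for every [e > 0], and truncating by [small_mod] puts [h] within [e] of
    [L]. *)
Lemma umaj_neg_mod h : ust h = h -> umaj h <= 0 -> umaj (- h) <= 0 ->
  forall e, 0 < e -> exists2 i, I i & nm (h - i) <= e.
Proof.
move=> hs h1 h2 e e0.
have up x : umaj x <= 0 -> ust x = x -> exists l : U, I l /\ pos (rs e - x - l).
  move=> x0 xs; have [t [l [Il ls pl]]] := inf_adherent e0 (upper_has_inf x).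
  rewrite -/(umaj x) => te; exists l; split=> //.
  have -> : rs e - x - l = (rs t - hpart x - l) + rs (e - t).
    by rewrite hpart_id// (rsD e) rsN; ncring.
  by apply: posD => //; apply: pos_rs; lra.
have [l [Il pl]] := up _ h1 hs.
have [k [Ik pk]] := up _ h2 (etrans (ustN h) (congr1 _ hs)).
by apply: (small_mod unitz_idealP e0 hs Il Ik) => //; move: pk; rewrite opprK.
Qed.

Section BelowUmaj.
Variables (f : U -> R) (lf : rlin f) (fle : forall x, f x <= umaj x).

Lemma below_le x t : upper x t -> f x <= t.
Proof. by move=> h; apply: le_trans (fle x) (umaj_le h). Qed.
Lemma below_pos y : pos y -> 0 <= f y.
Proof.
move=> py; have : upper (- y) 0.
  exists 0; split; [by case: unitz_idealP | exact: ust0 |].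
  by rewrite hpart_id ?ustN ?pos_sa// rs0 subr0 sub0r opprK.
by move/below_le; rewrite rlinN//; lra.
Qed.
Lemma below_ideal (l : U) : I l -> ust l = l -> f l = 0.
Proof.
have le (k : U) : I k -> ust k = k -> f k <= 0.
  move=> Ik ks; apply: below_le; exists (- k); split.
  - exact: uidealN unitz_idealP _ Ik.
  - by rewrite ustN ks.
  by rewrite hpart_id// rs0 sub0r opprK addNr; exact: pos0.
move=> Il ls; apply/eqP; rewrite eq_le le//=.
have : f (- l) <= 0.
  by apply: le; [exact: uidealN unitz_idealP _ Il|rewrite ustN ls].
by rewrite rlinN//; lra.
Qed.
Lemma below_skew x : ust x = - x -> f x = 0.
Proof.
have le y : ust y = - y -> f y <= 0.
  move=> ys; apply: below_le; exists 0.
  split; [by case: unitz_idealP | exact: ust0 |].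
  by rewrite hpart_skew// rs0 !subr0; exact: pos0.
move=> xs; apply/eqP; rewrite eq_le le//=.
have : f (- x) <= 0 by apply: le; rewrite ustN xs.
by rewrite rlinN//; lra.
Qed.
Lemma below_rs t : f (rs t) = t.
Proof.
have le s : f (rs s) <= s.
  apply: below_le; exists 0; split; [by case: unitz_idealP | exact: ust0 |].
  by rewrite hpart_id ?ust_rs// subrr subr0; exact: pos0.
apply/eqP; rewrite eq_le le /=; have := le (- t); rewrite rsN rlinN//; lra.
Qed.
Lemma below_nm x : f x <= nm x.
Proof. exact: below_le (upper_nm x). Qed.

(** The complex-linear functional on [A] with real part [f], namely [f (a) - i f (i a)]. *)
Definition functional_of a : C := f (emb a) +i* (- f (emb ('i%C *: a))).

Lemma functional_of_scalar : scalar functional_of.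
Proof.
have [fD fZ] := lf.
have fC c a : f (emb (c *: a)) = re c * f (emb a) + im c * f (emb ('i%C *: a)).
  rewrite -!fZ -fD -!embZ -embD scalerA -scalerDl; congr (f (emb (_ *: _))).
  by case: c => [c c'] /=; simpc.
move=> c a b; rewrite /functional_of !scalerDr !embD !fD scalerA (fC c) (fC ('i%C * c)).
by apply: complexP; rewrite ?(reD, imD, reM, imM) /=; ring.
Qed.

Lemma functional_ofE x : re (functional_of x.1) + re x.2 = f x.
Proof.
case: x => [a [s s']] /=.
have -> : (a, s +i* s') = emb a + (rs s + 'i%C *: rs s').
  congr (_, _); first by rewrite /= !scaler0 !addr0.
  change (s +i* s' = 0 + ((rs s : U).2 + 'i%C * (rs s' : U).2)).
  by rewrite !usnd_rs; apply: complexP; rewrite !(reD, imD, reM, imM) /=; ring.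
rewrite !lf.1 (below_rs s) (below_skew (x := 'i%C *: rs s')) ?addr0//.
by rewrite ustZ ust_rs -scaleNr; congr (_ *: _); simpc.
Qed.

(** Multiplying [a] by the conjugate of its value makes that value real, where the bound on [f]
    applies. *)
Lemma functional_of_contractive : contractive functional_of.
Proof.
move=> a; set z := functional_of a.
have [z0|z0] := eqVneq (modc z) 0; first by rewrite z0 nA_ge0.
have m0 : 0 < modc z by rewrite lt_neqAle eq_sym z0 modc_ge0.
have h c : re (c * z) <= modc c * nA a.
  rewrite -functionalZ; last exact: functional_of_scalar.
  rewrite /functional_of /=; apply: le_trans (below_nm _) _.
  by apply: le_trans (nm_emb _) _; rewrite nAZ.
have := h (conjc z); rewrite modcJ.
have -> : re (conjc z * z) = modc z * modc z.
  by rewrite -expr2 modc_sqr reM reJ imJ; ring.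
by rewrite ler_pM2l.
Qed.

Lemma functional_of_ge0 a : 0 <= functional_of (cstar a ** a).
Proof.
rewrite lecE /= embZ below_skew; last first.
  rewrite ustZ emb_star cstarM cstarK -scaleNr; congr (_ *: _); simpc.
  by [].
rewrite oppr0 eqxx /= embM -emb_star; apply: below_pos; exact: pos_ust_mul.
Qed.

End BelowUmaj.
End Ideals.

(** * Separation and extension of states *)

Section StateFunctional.
Context {R : realType} {A : cstarAlgType R}.
Local Notation C := R[i].
Local Notation U := (unitz A).
Implicit Types (a b : A) (x y : U) (t s : R) (phi psi : A -> C).

(** The real part of the extension of [phi] to the unitization with value 1 at the unit. It undoes
    [functional_of], see [functional_ofE]. *)
Definition re_ext phi x : R := re (phi x.1) + re x.2.

Lemma re_ext_rlin phi : scalar phi -> rlin (re_ext phi).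
Proof.
move=> l; split=> [x y|t x]; rewrite /re_ext /=.
  by rewrite functionalD// !reD addrACA.
by rewrite functionalZ// !reM /= !mul0r !subr0 mulrDr.
Qed.

Lemma re_ext_inj phi psi : scalar phi -> scalar psi -> re_ext phi = re_ext psi ->
  phi = psi.
Proof.
move=> lphi lpsi e; have E a : re (phi a) = re (psi a).
  by have := congr1 (fun f => f (emb a)) e; rewrite /re_ext /= !addr0.
apply/funext => a; apply: complexP => //.
by have := E ('i%C *: a); rewrite !functionalZ// !reM /=; lra.
Qed.

Variables (E : set A) (au : approx_unital E).

Section Positive.
Variables (phi : A -> C) (lphi : scalar phi).
Hypotheses (phi_ge0 : forall a, 0 <= phi (cstar a ** a)) (phi1 : contractive phi).

(** A positive element is the square of [a + s] with [a] self-adjoint and [s] real. By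
    [state_sqr_le] its value is at least [(phi a + s)^2]. *)
Lemma re_ext_pos y : pos y -> 0 <= re_ext phi y.
Proof.
move=> /pos_root[[a s] [/pos_sa ws <- _]].
have [as_ ss] : cstar a = a /\ conjc s = s.
  by move: ws => /(congr1 (fun x : U => (x.1, x.2))) [].
have st := state_star au lphi phi_ge0 phi1 a; rewrite as_ in st.
have sq := state_sqr_le au lphi phi_ge0 phi1 a; rewrite as_ in sq.
rewrite /re_ext /= !(functionalD _ _ lphi) !(functionalZ _ _ lphi) !reD !reM.
move: st ss sq; rewrite modc_sqr => /(congr1 (@im _)) + /(congr1 (@im _)).
rewrite !imJ => j0 s0.
have -> : im (phi a) = 0 by lra.
have -> : im s = 0 by lra.
by have := sqr_ge0 (re (phi a) + re s); lra.
Qed.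

Lemma re_ext_skew x : ust x = - x -> re_ext phi x = 0.
Proof.
move=> xs; have [as_ ss] : cstar x.1 = - x.1 /\ conjc x.2 = - x.2.
  by move: xs => /(congr1 (fun x : U => (x.1, x.2))) [].
have := state_star au lphi phi_ge0 phi1 x.1; rewrite as_ functionalN// /re_ext.
move=> /(congr1 (@re _)); move: ss => /(congr1 (@re _)).
by rewrite !reJ !reN; lra.
Qed.

Lemma re_ext_rs t : re_ext phi (rs t) = t.
Proof. by rewrite /re_ext usnd_rs ufst_rs functional0//= add0r. Qed.

Lemma re_ext_hpart x : re_ext phi (hpart x) = re_ext phi x.
Proof.
have [fD fZ] := re_ext_rlin lphi.
rewrite /hpart rsZ fZ fD.
have : re_ext phi (x - ust x) = 0.
  by apply: re_ext_skew; rewrite ustB ustK opprB.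
by rewrite fD (rlinN _ (re_ext_rlin lphi)); lra.
Qed.

Lemma re_ext_le_umaj (L : set A) x : closed_ideal L -> vanishing_on L phi ->
  re_ext phi x <= umaj L x.
Proof.
move=> Lid v; apply: le_umaj => // t [l [[l2 Ll] ls pl]].
have fl : re_ext phi l = 0 by rewrite /re_ext l2 v// add0r.
have lf := re_ext_rlin lphi.
by have := re_ext_pos pl; rewrite !lf.1 !rlinN// fl re_ext_rs re_ext_hpart; lra.
Qed.

End Positive.
End StateFunctional.

Section Convex.
Context {R : realType} {A : cstarAlgType R}.
Variables (E : set A) (au : approx_unital E).
Local Notation C := R[i].

(** On [l^* l] both values are nonnegative and a strictly convex combination of them is 0, so each
    is 0. *)
Lemma convex_vanishing (L : set A) (phi psi1 psi2 : A -> C) (t : R) :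
  closed_ideal L -> vanishing_on L phi ->
  states A psi1 -> states A psi2 -> 0 < t < 1 ->
  (forall a, phi a = t%:C * psi1 a + (1 - t)%:C * psi2 a) ->
  vanishing_on L psi1 /\ vanishing_on L psi2.
Proof.
move=> Lid v /stateP[l1 p1 c1] /stateP[l2 p2 c2] /andP[t0 t1] e.
have h l : L l -> re (psi1 (cstar l ** l)) = 0 /\ re (psi2 (cstar l ** l)) = 0.
  move=> Ll; have [q1 _] := ge0P (p1 l); have [q2 _] := ge0P (p2 l).
  have := v _ (cidealMl Lid (cstar l) Ll).
  rewrite e => /(congr1 (@re _)); rewrite reD !reM /= !mul0r !subr0.
  by move=> z; split; nra.
by split; apply: (state_null au) => // l Ll; have [] := h _ Ll.
Qed.

Lemma re_ext_convex (phi psi1 psi2 : A -> C) (t : R) :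
  (forall a, phi a = t%:C * psi1 a + (1 - t)%:C * psi2 a) ->
  forall x, re_ext phi x = t * re_ext psi1 x + (1 - t) * re_ext psi2 x.
Proof. by move=> e x; rewrite /re_ext e reD !reM /= !mul0r !subr0; ring. Qed.

End Convex.

Section Separation.
Context {R : realType} {A : cstarAlgType R}.
Variables (E : set A) (au : approx_unital E) (L : set A) (Lid : closed_ideal L).
Local Notation C := R[i].
Local Notation U := (unitz A).

(** The ray through [(emb k, m)] forces [f] to attain the maximal value [m] at [k]; an extreme such
    functional is a pure state. *)
Lemma pure_state_umaj_pos (k : A) : 0 < umaj L (emb k) ->
  exists2 psi, pure_states A psi & vanishing_on L psi /\ psi k <> 0.
Proof.
set m := umaj L (emb k) => m0.
have hp := umaj_sublin Lid.
pose G := [set u : U * R | exists2 s, 0 <= s & u = (s%:C *: emb k, s * m)].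
have G0 : G (0, 0) by exists 0 => //; rewrite scale0r mul0r.
have GD u v : G u -> G v -> G (u.1 + v.1, u.2 + v.2).
  move=> [t t0 ->] [s s0 ->]; exists (t + s); first exact: addr_ge0.
  by rewrite rmorphD scalerDl mulrDl.
have GZ t u : 0 <= t -> G u -> G (t%:C *: u.1, t * u.2).
  move=> t0 [s s0 ->]; exists (t * s); first exact: mulr_ge0.
  by rewrite rmorphM -scalerA mulrA.
have Gp u : G u -> u.2 <= umaj L u.1 by move=> [t t0 ->] /=; rewrite hp.2.
have G1 : G (emb k, m) by exists 1 => //; rewrite scale1r mul1r.
have [f [lf fc fext]] := extreme_le_sublin (cone_cut_sublin hp G0 GD GZ Gp).
have fle x : f x <= umaj L x by apply: le_trans (fc x) (cone_cut_le_p hp G0 Gp x).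
have fk : f (emb k) = m.
  apply/eqP; rewrite eq_le fle /=.
  by have := le_trans (fc _) (cone_cutN hp G0 Gp G1); rewrite rlinN// lerN2.
pose psi := functional_of f.
have lpsi : scalar psi by exact: functional_of_scalar.
have ppsi : forall a, 0 <= psi (cstar a ** a) by exact: (functional_of_ge0 Lid lf fle).
have cpsi : contractive psi by exact: (functional_of_contractive Lid lf fle).
have spsi : re_ext psi = f by apply/funext => x; exact: (functional_ofE Lid lf fle).
have vpsi : vanishing_on L psi.
  apply: (state_null au) => // l Ll; rewrite /psi /functional_of /=.
  apply: (below_ideal Lid lf fle).
    by split => //; exact: cidealMl.
  by rewrite emb_star cstarM cstarK.
have rek : re (psi k) = m by [].
have nn0 : 0 < modc (psi k) by apply: lt_le_trans (Re_le_modc _); rewrite rek.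
(* If the norm of [psi] were at most [1 - e], then [psi / (1 - e)] would still be positive,
   contractive and zero on [L], yet would exceed the maximum [m > 0] at [k]. That [1 - e] is
   positive follows from [psi k] being nonzero. *)
have norm1 e : 0 < e -> exists2 a, nA a <= 1 & 1 - e < modc (psi a).
  move=> e0; apply: contrapT => h.
  have {}h a : nA a <= 1 -> modc (psi a) <= 1 - e.
    by move=> a1; rewrite leNgt; apply/negP => ?; apply: h; exists a.
  have e1 : 0 < 1 - e.
    have := h ((nA k)^-1%:C *: k); rewrite nAZ modcR normfV ger0_norm ?nA_ge0//.
    have k0 : 0 < nA k by apply: lt_le_trans nn0 (cpsi k).
    rewrite mulVf ?gt_eqF// lexx functionalZ// modcM modcR normfV gtr0_norm//.
    by move=> /(_ isT); apply: lt_le_trans; rewrite mulr_gt0 ?invr_gt0.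
  pose c := (1 - e)^-1; have c0 : 0 < c by rewrite invr_gt0.
  pose psi' a := c%:C * psi a.
  have lpsi' : scalar psi'.
    by move=> d a b; rewrite /psi' lpsi mulrDr mulrCA.
  have ppsi' a : 0 <= psi' (cstar a ** a) by rewrite mulr_ge0 ?ppsi// ler0c ltW.
  have cpsi' : contractive psi'.
    move=> a; rewrite modcM modcR gtr0_norm// mulrC ler_pdivrMr//.
    have := nA_ge0 a; rewrite le_eqVlt => /predU1P[a0|a0].
      by have := cpsi a; rewrite -a0 mul0r.
    have := h ((nA a)^-1%:C *: a); rewrite nAZ modcR normfV gtr0_norm//.
    rewrite mulVf ?gt_eqF// lexx functionalZ// modcM modcR normfV gtr0_norm//.
    by move=> /(_ isT); rewrite mulrC ler_pdivrMr// mulrC.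
  have vpsi' : vanishing_on L psi' by move=> a La; rewrite /psi' vpsi// mulr0.
  have := re_ext_le_umaj au lpsi' ppsi' cpsi' (emb k) Lid vpsi'.
  have -> : re_ext psi' (emb k) = re (c%:C * psi k) + 0 by [].
  rewrite -/m addr0 reM mul0r subr0 rek.
  by rewrite ger_pMl// /c invf_le1//; lra.
have stpsi : states A psi by split=> //; apply/functional_norm1P.
exists psi; last by split=> // k0; move: nn0; rewrite k0 (modcR 0) normr0 ltxx.
split=> // psi1 psi2 t st1 st2 t01 e.
have [v1 v2] := convex_vanishing au Lid vpsi st1 st2 t01 e.
have [l1 p1 c1] := stateP st1; have [l2 p2 c2] := stateP st2.
have le1 x := re_ext_le_umaj au l1 p1 c1 x Lid v1.
have le2 x := re_ext_le_umaj au l2 p2 c2 x Lid v2.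
have E12 := re_ext_convex e.
(* Two values at most [m] with convex combination [m] are both [m], so the components obey the
   constraint defining the cut. *)
have [k1 k2] : re_ext psi1 (emb k) = m /\ re_ext psi2 (emb k) = m.
  have := E12 (emb k); rewrite spsi fk.
  have := le1 (emb k); have := le2 (emb k); rewrite -/m => q2 q1 q.
  by case/andP: t01 => t0 t1; split; nra.
have cq psi0 : scalar psi0 -> (forall x, re_ext psi0 x <= umaj L x) ->
    re_ext psi0 (emb k) = m -> forall x, re_ext psi0 x <= cone_cut (umaj L) G x.
  move=> l0 le0 k0; have ls := re_ext_rlin l0.
  by apply: rlin_le_cone_cut => // _ [s s0 ->] /=; rewrite ls.2 k0.
have [e1 e2] : re_ext psi1 = f /\ re_ext psi2 = f.
  apply: (fext _ _ t) => //; try exact: re_ext_rlin; try exact: cq.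
  by move=> x; rewrite -spsi E12.
by split; apply: re_ext_inj; rewrite ?spsi.
Qed.

Lemma pure_state_separation_sa (h : A) : cstar h = h -> ~ L h ->
  exists2 psi, pure_states A psi & vanishing_on L psi /\ psi h <> 0.
Proof.
move=> hs Lh.
have [p|np] := ltP 0 (umaj L (emb h)); first exact: pure_state_umaj_pos.
have [p|nn] := ltP 0 (umaj L (emb (- h))).
  have [psi ppsi [v k]] := pure_state_umaj_pos p; exists psi => //; split=> //.
  by move=> h0; apply: k; rewrite functionalN ?h0 ?oppr0//; case: ppsi => -[[]].
have sh : ust (emb h : U) = emb h by rewrite emb_star hs.
rewrite embN in nn; have approx := umaj_neg_mod Lid sh np nn.
exfalso; apply: Lh; apply: closed_approx; first by case: Lid.
clear np nn => e e0; have e20 : 0 < e / 2 by lra.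
have [i [_ Li] le] := approx _ e20.
exists i.1 => //; have := nA_le_unm (emb h - i) => /= /le_trans; apply.
by move: le; rewrite /nm /=; lra.
Qed.

(** If both self-adjoint parts of [b] lay in [L], so would [b]. A state sees the escaping part only
    if it does not kill [b], because killing [b] entails killing [b^*]. *)
Lemma pure_state_separation (b : A) : ~ L b ->
  exists2 psi, pure_states A psi & vanishing_on L psi /\ psi b <> 0.
Proof.
move=> Lb; pose b1 := b + cstar b; pose b2 := 'i%C *: (b - cstar b).
have s1 : cstar b1 = b1 by rewrite /b1 cstarD cstarK addrC.
have s2 : cstar b2 = b2.
  rewrite /b2 cstarZ cstarD cstarN cstarK -opprB scalerN -scaleNr.
  by congr (_ *: _); simpc.
have bE : b = (2^-1 : C) *: (b1 - 'i%C *: b2).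
  rewrite /b1 /b2 scalerA; have -> : 'i * 'i = -1 :> C by simpc.
  rewrite scaleN1r opprK addrACA subrr addr0.
  have -> : b + b = (1 + 1 : C) *: b by rewrite scalerDl scale1r.
  by rewrite scalerA mulVf ?scale1r// pnatr_eq0.
have [j [sj Lj jb]] : exists j, [/\ cstar j = j, ~ L j &
    forall psi, scalar psi -> psi b = 0 -> psi (cstar b) = 0 -> psi j = 0].
  have [L1|L1] := pselect (L b1).
    exists b2; split=> // [L2|psi l e1 e2].
      apply: Lb; rewrite bE; apply: (cidealZ Lid); apply: (cidealD Lid) => //.
      by apply: (cidealN Lid); apply: (cidealZ Lid).
    by rewrite /b2 functionalZ// functionalB// e1 e2 subrr mulr0.
  by exists b1; split=> // psi l e1 e2; rewrite /b1 functionalD// e1 e2 addr0.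
have [psi ppsi [v k]] := pure_state_separation_sa sj Lj.
exists psi => //; split=> // b0; apply: k.
have [l p c] := stateP ppsi.1.
by apply: jb => //; rewrite (state_star au l p c) b0 conjc0.
Qed.

End Separation.

Section Extension.
Context {R : realType} {A B : cstarAlgType R}.
Variables (iota : B -> A) (inc : cstar_inclusion iota).
Local Notation C := R[i].

Lemma iotaL : linear iota. Proof. by case: inc. Qed.
Lemma iotaD a b : iota (a + b) = iota a + iota b.
Proof. by have := iotaL 1 a b; rewrite !scale1r. Qed.
Lemma iota0 : iota 0 = 0.
Proof. by apply: (addrI (iota 0)); rewrite -iotaD !addr0. Qed.
Lemma iotaZ (c : C) a : iota (c *: a) = c *: iota a.
Proof. by have := iotaL c a 0; rewrite iota0 !addr0. Qed.
Lemma iotaN a : iota (- a) = - iota a.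
Proof. by rewrite -scaleN1r iotaZ scaleN1r. Qed.
Lemma iotaM a b : iota (a ** b) = iota a ** iota b.
Proof. by case: inc => _ h _ _; exact: h. Qed.
Lemma iota_star a : iota (cstar a) = cstar (iota a).
Proof. by case: inc => _ _ h _; exact: h. Qed.
Lemma nA_iota a : nA (iota a) = nA a.
Proof. by case: inc => _ _ _ h; rewrite /nA h. Qed.

Definition uiota (x : unitz B) : unitz A := (iota x.1, x.2).

Lemma uiotaD x y : uiota (x + y) = uiota x + uiota y.
Proof. by rewrite /uiota /= iotaD. Qed.
Lemma uiotaN x : uiota (- x) = - uiota x.
Proof. by rewrite /uiota /= iotaN. Qed.
Lemma uiotaB x y : uiota (x - y) = uiota x - uiota y.
Proof. by rewrite uiotaD uiotaN. Qed.
Lemma uiotaZ (c : C) x : uiota (c *: x) = c *: uiota x.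
Proof. by rewrite /uiota /= iotaZ. Qed.
Lemma uiotaM x y : uiota (x * y) = uiota x * uiota y.
Proof. by rewrite /uiota /= !iotaD iotaM !iotaZ. Qed.
Lemma uiota1 : uiota 1 = 1.
Proof. by rewrite /uiota /= iota0. Qed.
Lemma uiota_rs t : uiota (rs t) = rs t.
Proof. by rewrite /rs uiotaZ uiota1. Qed.
Lemma uiota_ust x : uiota (ust x) = ust (uiota x).
Proof. by rewrite /uiota /= iota_star. Qed.

(** The constant is [2 + 1], from [nA_le_unm] and [modc_unm]. Only continuity matters: it carries
    [uiota] through the limit defining roots. *)
Lemma nm_uiota x : nm (uiota x) <= 3 * nm x.
Proof.
apply: le_trans (unm_le_sum _) _; rewrite /= nA_iota.
by have := nA_le_unm x; have := modc_unm x; rewrite /nm /=; lra.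
Qed.

Lemma uiota_sqrt_iter w n : uiota (sqrt_iter w n) = sqrt_iter (uiota w) n.
Proof.
elim: n => [|n IH] /=; first by rewrite -(@rs0 R (unitz B)) uiota_rs rs0.
by rewrite uiotaM uiota_rs uiotaD uiotaM IH.
Qed.

Lemma uiota_sqrt_lim w : nm w <= 1 -> nm (uiota w) <= 1 ->
  uiota (sqrt_lim w) = sqrt_lim (uiota w).
Proof.
move=> w1 w1'; apply: cvN_uniq (sqrt_limP w1').
move=> e e0; have /(sqrt_limP w1)[n0 h] : 0 < e / 3 by rewrite divr_gt0.
exists n0 => n /h; rewrite -uiota_sqrt_iter -uiotaB ler_pdivlMr// mulrC.
exact: le_trans (nm_uiota _).
Qed.

Lemma uiota_psqrt t x : pbound t x -> pbound t (uiota x) ->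
  uiota (psqrt t x) = psqrt t (uiota x).
Proof.
move=> px px'; have E : uiota (1 - rs t^-1 * x) = 1 - rs t^-1 * uiota x.
  by rewrite uiotaB uiotaM uiota1 uiota_rs.
rewrite /psqrt uiotaM uiota_rs uiotaB uiota1 uiota_sqrt_lim ?E//; exact: pbound_arg.
Qed.

Variables (au : approx_unital (range iota)).

Lemma approx_unital_sub : approx_unital [set: B].
Proof.
move=> b e /(au (iota b))[_ [[u _ <-] us u1 h]]; exists u.
rewrite -nA_iota -(nA_iota (_ - _)) iotaD iotaN iotaM; split=> //.
have : nA (iota (cstar u - u)) = 0 by rewrite iotaD iotaN iota_star us subrr nA0.
by rewrite nA_iota => /nA_eq0/eqP; rewrite subr_eq0 => /eqP.
Qed.

(** For [a] nearly norming [psi] and [u] from [B] with [u a] close to [a], Cauchy-Schwarz bounds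
    [|psi (u a)|^2] by [psi (u^2)]. Hence [u^2], which lies in [B], nearly norms the restriction. *)
Lemma restrict_state psi : states A psi -> states B (psi \o iota).
Proof.
move=> st; have [l p c] := stateP st.
have l' : scalar (psi \o iota) by move=> d a b /=; rewrite iotaL l.
split; first by split=> // a /=; rewrite iotaM iota_star.
apply/(functional_norm1P l'); split=> [a|e e0].
  by rewrite -nA_iota; exact: c.
have e40 : 0 < e / 4 by lra.
have [_ /(_ _ e40)[a a1 ha]] := (functional_norm1P l).1 st.2.
have [_ [[u _ <-] us u1 h]] := au a e40.
exists (u ** u).
  by apply: le_trans (nAM _ _) _; rewrite -nA_iota; have := nA_ge0 (iota u); nra.
apply: lt_le_trans (Re_le_modc _); rewrite /= iotaM.
have [_] := positive_cs l p a (iota u); rewrite us.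
have : re (psi (cstar a ** a)) <= 1.
  apply: le_trans (Re_le_modc _) _; apply: le_trans (c _) _.
  by rewrite nA_star_mul; have := nA_ge0 a; nra.
have : 0 <= re (psi (iota u ** iota u)).
  by have := p (iota u); rewrite us => /ge0P[].
have : 1 - 2 * (e / 4) < modc (psi (iota u ** a)).
  have := contractiveB l c (iota u ** a) a.
  have := modcD (psi (iota u ** a)) (- (psi (iota u ** a) - psi a)).
  by rewrite modcN opprB addrC subrK; lra.
move: (modc _) (re _) (re _) (modc_ge0 (psi (iota u ** a))).
move=> X p1 q X0 Xe q0 p1le Xq.
have : X ^+ 2 <= q by nra.
(* From [X > 1 - e/2] and [X^2 >= 2 X - 1] one gets [q > 1 - e], which explains the choice of
   [e / 4]. *)
by have := sqr_ge0 (X - 1); lra.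
Qed.

Variables (L : set A) (Lid : closed_ideal L).

Lemma closed_ideal_preimage : closed_ideal (iota @^-1` L).
Proof.
have [Lc L0 _ _] := Lid; split.
- move=> b cb; apply: (closed_approx (L := L) Lc) => e e0.
  have [] := cb (ball b e%:C); first by apply: nbhsx_ballx; rewrite ltcR.
  move=> c [/= Lc']; rewrite -ball_normE /= -nAE ltcR => /ltW h.
  by exists (iota c) => //; rewrite -iotaN -iotaD nA_iota.
- by rewrite /= iota0.
- move=> c x y /= Lx Ly; rewrite iotaL; apply: (cidealD Lid) => //.
  exact: (cidealZ Lid).
- move=> a x /= Lx; rewrite !iotaM; split; [exact: (cidealMl Lid)|exact: (cidealMr Lid)].
Qed.

Section ExtendState.
Variables (phi : B -> C) (stphi : states B phi)
  (vphi : vanishing_on (iota @^-1` L) phi).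

Let lphi : scalar phi. Proof. by have [] := stateP stphi. Qed.

Lemma uiota_ideal_null x : unitz_ideal L (uiota x) -> re_ext phi x = 0.
Proof. by case: x => b s [/= s0 Lb]; rewrite /re_ext /= s0 vphi// add0r. Qed.

(** With [y = t - Re x], positivity of [y - l] over [A] makes [|y| - y] an element of [L] by
    [abs_mod]. Roots commute with [uiota], so this element comes from [B] and [phi] kills it. Thus
    [t - re phi (x)] equals the value at [|y|], which is nonnegative. *)
Lemma re_ext_le_umaj_uiota x : re_ext phi x <= umaj L (uiota x).
Proof.
have [_ p c] := stateP stphi; have auB := approx_unital_sub.
have lf := re_ext_rlin lphi.
apply: le_umaj => // t [l [Il ls pl]].
have [y yd] : exists y : unitz B, y = rs t - hpart x by exists (rs t - hpart x).
have ys : ust y = y by rewrite yd ustB ust_rs hpart_sa.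
have yE : uiota y = rs t - hpart (uiota x).
  by rewrite yd uiotaB uiota_rs /hpart uiotaM uiota_rs uiotaD uiota_ust.
have ys' : ust (uiota y) = uiota y by rewrite -uiota_ust ys.
have [s [ps ps']] : exists s, pbound s (y * y) /\ pbound s (uiota y * uiota y).
  have [_ [t1 p1]] := pos_sqr ys; have [_ [t2 p2]] := pos_sqr ys'.
  exists (Num.max t1 t2).
  by split; [apply: pboundW p1 | apply: pboundW p2]; rewrite le_max lexx ?orbT.
have Uid := unitz_idealP Lid.
have pl' : pos (uiota y + - l) by rewrite yE.
have := abs_mod Uid ys' ps' (uidealN Uid Il) pl'.
have -> : psqrt s (uiota y * uiota y) - uiota y = uiota (psqrt s (y * y) - y).
  by rewrite uiotaB (uiota_psqrt ps) uiotaM.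
move=> /uiota_ideal_null z0.
have : 0 <= re_ext phi (psqrt s (y * y)).
  by apply: (re_ext_pos auB lphi p c); apply: psqrt_pos => //; rewrite ustM ys.
move: z0; rewrite yd !lf.1 !rlinN// lf.1 rlinN// re_ext_rs// (re_ext_hpart auB lphi p c).
by lra.
Qed.

(** The cone is the graph of [re_ext phi], a real subspace, so its inequalities prescribe exact
    values on [B]. Norm 1 is inherited from [phi], as [iota] is isometric. *)
Theorem extend_state : exists psi, [/\ states A psi, psi \o iota = phi,
  vanishing_on L psi & pure_states B phi -> pure_states A psi].
Proof.
have [_ p c] := stateP stphi.
have lf0 := re_ext_rlin lphi.
have hp := umaj_sublin Lid.
pose G := [set u : unitz A * R | exists x, u = (uiota x, re_ext phi x)].
have G0 : G (0, 0) by exists 0; rewrite /uiota /re_ext /= iota0 functional0// addr0.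
have GD u v : G u -> G v -> G (u.1 + v.1, u.2 + v.2).
  by move=> [x ->] [y ->]; exists (x + y); rewrite uiotaD lf0.1.
have GZ t u : 0 <= t -> G u -> G (t%:C *: u.1, t * u.2).
  by move=> t0 [x ->]; exists (t%:C *: x); rewrite uiotaZ lf0.2.
have Gp u : G u -> u.2 <= umaj L u.1.
  by move=> [x ->]; exact: re_ext_le_umaj_uiota.
have [f [lf fc fext]] := extreme_le_sublin (cone_cut_sublin hp G0 GD GZ Gp).
have fle x : f x <= umaj L x by apply: le_trans (fc x) (cone_cut_le_p hp G0 Gp x).
have fphi x : f (uiota x) = re_ext phi x.
  have h y : re_ext phi y <= f (uiota y).
    have Gy : G (uiota y, re_ext phi y) by exists y.
    by have := le_trans (fc _) (cone_cutN hp G0 Gp Gy); rewrite /= rlinN// lerN2.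
  apply/eqP; rewrite eq_le h andbT.
  by have := h (- x); rewrite uiotaN !rlinN// lerN2.
pose psi := functional_of f.
have lpsi : scalar psi by exact: functional_of_scalar.
have ppsi : forall a, 0 <= psi (cstar a ** a) by exact: (functional_of_ge0 Lid lf fle).
have cpsi : contractive psi by exact: (functional_of_contractive Lid lf fle).
have spsi : re_ext psi = f by apply/funext => x; exact: (functional_ofE Lid lf fle).
have vpsi : vanishing_on L psi.
  apply: (state_null au) => // l Ll; rewrite /psi /functional_of /=.
  apply: (below_ideal Lid lf fle).
    by split => //; exact: (cidealMl Lid).
  by rewrite emb_star cstarM cstarK.
have rpsi : psi \o iota = phi.
  have l' : scalar (psi \o iota) by move=> d a b /=; rewrite iotaL lpsi.
  apply: re_ext_inj => //; apply/funext => x.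
  by rewrite -fphi -spsi.
have stpsi : states A psi.
  split=> //; apply/functional_norm1P => //; split=> // e e0.
  have [_ /(_ _ e0)[b b1 hb]] := (functional_norm1P lphi).1 stphi.2.
  by exists (iota b); rewrite ?nA_iota//; move: hb; rewrite -rpsi.
exists psi; split=> // -[_ phipure]; split=> // psi1 psi2 t st1 st2 t01 e.
have [v1 v2] := convex_vanishing au Lid vpsi st1 st2 t01 e.
have [l1 p1 c1] := stateP st1; have [l2 p2 c2] := stateP st2.
(* Purity of [phi] makes both components restrict to [phi], and they vanish on [L]; both therefore
   lie below the cut, where [f] is extreme. *)
have [r1 r2] : psi1 \o iota = phi /\ psi2 \o iota = phi.
  apply: (phipure _ _ t) => //; try exact: restrict_state.
  by move=> b; rewrite -rpsi /= e.
have cq psi0 : scalar psi0 -> (forall x, re_ext psi0 x <= umaj L x) ->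
    psi0 \o iota = phi -> forall x, re_ext psi0 x <= cone_cut (umaj L) G x.
  move=> l0 le0 r0; apply: rlin_le_cone_cut => //; first exact: re_ext_rlin.
  by move=> _ [x ->]; rewrite /= -r0.
have [e1 e2] : re_ext psi1 = f /\ re_ext psi2 = f.
  apply: (fext _ _ t) => //; try exact: re_ext_rlin.
  - by apply: cq => // x; exact: (re_ext_le_umaj au l1 p1 c1 x Lid v1).
  - by apply: cq => // x; exact: (re_ext_le_umaj au l2 p2 c2 x Lid v2).
  by move=> x; rewrite -spsi (re_ext_convex e).
by split; apply: re_ext_inj; rewrite ?spsi.
Qed.

End ExtendState.
End Extension.

Lemma nondegenerate_approx_unital (R : realType) (A B : cstarAlgType R)
  (iota : B -> A) : cstar_inclusion iota -> nondegenerate_inclusion iota ->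
  approx_unital (range iota).
Proof.
move=> inc [I [F [e [FF ep el]]]] a d d0.
have [/cvgrPdist_le/(_ d%:C) h _] := el a.
have /filter_ex[i hi] : F [set i | `|a - iota (e i) ** a| <= d%:C].
  by apply: h; rewrite ltcR.
exists (iota (e i)); have [[b eb] e1] := ep i; split.
- by exists (e i).
- by rewrite -(iota_star inc) eb cstarM cstarK.
- by rewrite (nA_iota inc) -nA_le1.
by rewrite nABC -lecR nAE.
Qed.

(** * Lifts and dominance *)

Section Main.
Context {R : realType} {A B : cstarAlgType R}.
Variables (iota : B -> A) (inc : cstar_inclusion iota)
  (au : approx_unital (range iota)) (J : set A).
Local Notation C := R[i].
Local Notation I := (iota @^-1` J).

(** The purity clause in the hypothesis lets one statement serve arbitrary lifts and pure lifts: the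
    chosen extensions are pure whenever [Phi] consists of pure states. *)
Lemma lift_dominant (Phi : set (B -> C)) :
  Phi `<=` states B `&` vanishing_on I ->
  (forall Sigma, is_lift iota Phi Sigma ->
    (Phi `<=` pure_states B -> Sigma `<=` pure_states A) -> subordinated Sigma J) ->
  dominant_ideal iota J.
Proof.
move=> PhiI lifts L [Lid _] LI.
pose P phi := [set psi | [/\ states A psi, psi \o iota = phi,
  vanishing_on L psi & pure_states B phi -> pure_states A psi]].
have ext phi : Phi phi -> exists psi, P phi psi.
  move=> /PhiI[st v]; apply: extend_state => // b Lb; apply: v; exact: LI.
pose sg phi := xget 0 (P phi).
have sgP phi : Phi phi -> P phi (sg phi) by move=> /ext/(xgetPex 0).
have lift : is_lift iota Phi (sg @` Phi).
  split; first by move=> _ [phi /sgP[? _ _ _] <-].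
  split.
  - by move=> _ [phi Pphi <-]; have [_ -> _ _] := sgP _ Pphi.
  - move=> u v /set_mem[phi Pphi <-] /set_mem[phi' Pphi' <-].
    have [_ -> _ _] := sgP _ Pphi; have [_ -> _ _] := sgP _ Pphi'.
    by move->.
  - by move=> phi Pphi; have [_ ? _ _] := sgP _ Pphi; exists (sg phi); first exists phi.
apply: subset_trans (lifts _ lift _); last first.
  by move=> Pp _ [phi Pphi <-]; have [_ _ _] := sgP _ Pphi; apply; exact: Pp.
move=> a La _ [phi Pphi <-] x y; have [_ _ + _] := sgP _ Pphi; apply.
by apply: (cidealMr Lid); exact: (cidealMl Lid).
Qed.

Lemma map_kernel_closed_ideal (Sigma : set (A -> C)) : Sigma `<=` states A ->
  closed_ideal (family_kernel Sigma).
Proof.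
move=> Sst; split.
- move=> a ca psi Spsi x y; have [l p c] := stateP (Sst _ Spsi).
  apply/modc0_eq0/eqP; rewrite eq_le modc_ge0 andbT.
  apply/ler_addgt0Pl => e e0; rewrite addr0.
  set k := nA x * nA y + 1.
  have k0 : 0 < k by rewrite ltr_wpDl// mulr_ge0 ?nA_ge0.
  have [] := ca (ball a (e / k)%:C).
    by apply: nbhsx_ballx; rewrite ltcR divr_gt0.
  move=> b [/= Kb]; rewrite -ball_normE /= -nAE ltcR => /ltW h.
  have -> : psi (x ** a ** y) = psi (x ** (a - b) ** y).
    by rewrite cmulBr cmulBl functionalB// (Kb _ Spsi) subr0.
  apply: le_trans (c _) _; apply: le_trans (nAM _ _) _.
  apply: le_trans (ler_wpM2r (nA_ge0 y) (nAM _ _)) _.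
  move: h; rewrite ler_pdivlMr//; apply: le_trans.
  by rewrite /k; have := nA_ge0 (a - b); nra.
- move=> psi Spsi x y; have [l _ _] := stateP (Sst _ Spsi).
  by rewrite cmul0r cmul0l functional0.
- move=> c x y Kx Ky psi Spsi u v; have [l _ _] := stateP (Sst _ Spsi).
  by rewrite cmulDr cmulDl cmulZr cmulZl l (Kx _ Spsi) (Ky _ Spsi) mulr0 addr0.
move=> a x Kx; split=> psi Spsi u v.
  by rewrite cmulA (Kx _ Spsi).
by rewrite -cmulA -cmulA cmulA (Kx _ Spsi).
Qed.

(** Dominance is applied to the kernel of [Sigma] itself. Besides the trace condition this requires
    the kernel to be proper, hence [Sigma] to be nonempty. *)
Lemma dominant_lift : proper_closed_ideal J -> dominant_ideal iota J ->
  forall Sigma, is_lift iota (pure_states B `&` vanishing_on I) Sigma ->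
  subordinated Sigma J.
Proof.
move=> [Jid Jp] dom Sigma [Sst Sbij].
have auB := approx_unital_sub inc au.
have Iid := closed_ideal_preimage inc Jid.
(* If [B] were contained in [J], every [a] would be a limit of elements [u a] of the closed ideal
   [J], contradicting properness. *)
have [b0 Ib0] : exists b, ~ I b.
  apply: contrapT => h; apply: Jp; apply/seteqP; split=> // a _.
  apply: closed_approx; first by case: Jid.
  move=> e /(au a)[_ [[u _ <-] _ _ hu]]; exists (iota u ** a); last by rewrite nABC.
  by apply: (cidealMr Jid); apply: contrapT => nu; apply: h; exists u.
have [phi0 pphi0 [vphi0 _]] := pure_state_separation auB Iid Ib0.
have [psi0 Spsi0 _] : ((fun psi => psi \o iota) @` Sigma) phi0.
  by case: Sbij => _ _; apply.
apply: dom; first split.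
- exact: map_kernel_closed_ideal.
(* A member of [Sigma] whose kernel is all of [A] would be zero, against norm 1. *)
- move=> KT; have st0 := Sst _ Spsi0; have [l p c] := stateP st0.
  have psi00 a : psi0 a = 0.
    apply: (kernel_null au) => // x y.
    have : family_kernel Sigma a by rewrite KT.
    by move=> /(_ _ Spsi0); apply.
  have [_ /(_ 1 ltr01)[a _]] := (functional_norm1P l).1 st0.2.
  by rewrite psi00 (modcR 0) normr0 subrr ltxx.
move=> b Kb /=; apply: contrapT => Ib.
have [phi pphi [vphi phib]] := pure_state_separation auB Iid Ib.
apply: phib; have [l p c] := stateP pphi.1.
apply: (kernel_null auB) => // x y.
have [psi Spsi <-] : ((fun psi => psi \o iota) @` Sigma) phi.
  by case: Sbij => _ _; apply.
by rewrite /= !(iotaM inc); exact: Kb.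
Qed.

End Main.

Theorem theorem3p3 (R : realType) (A B : cstarAlgType R) (iota : B -> A)
    (J : set A) (iota_incl : cstar_inclusion iota) (iota_nondeg : nondegenerate_inclusion iota)
    (J_ideal : proper_closed_ideal J) :
  [<-> (* (i) *)
       dominant_ideal iota J;
       (* (ii) *)
       exists Phi : set (B -> R[i]),
         Phi `<=` states B `&` vanishing_on (iota @^-1` J) /\
         (forall Sigma : set (A -> R[i]),
            is_lift iota Phi Sigma -> subordinated Sigma J);
       (* (iii) *)
       exists Phi : set (B -> R[i]),
         Phi `<=` pure_states B `&` vanishing_on (iota @^-1` J) /\
         (forall Sigma : set (A -> R[i]),
            is_lift iota Phi Sigma -> subordinated Sigma J);
       (* (iii') *)
       exists Phi : set (B -> R[i]),
         Phi `<=` pure_states B `&` vanishing_on (iota @^-1` J) /\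
         (forall Sigma : set (A -> R[i]),
            is_pure_lift iota Phi Sigma -> subordinated Sigma J)].
Proof.
have au := nondegenerate_approx_unital iota_incl iota_nondeg.
have dom_lift := dominant_lift iota_incl au J_ideal.
tfae.
- move=> /dom_lift h; exists (pure_states B `&` vanishing_on (iota @^-1` J)).
  by split=> // phi [[st _] v].
(* The given [Phi] serves only to prove dominance; the family of all pure states on the quotient
   then replaces it. *)
- move=> [Phi [PhiI lifts]]; exists (pure_states B `&` vanishing_on (iota @^-1` J)).
  split=> //; apply: dom_lift; apply: (lift_dominant iota_incl au PhiI).
  by move=> Sigma /lifts.
- by move=> [Phi [PhiI lifts]]; exists Phi; split=> // Sigma [/lifts].
move=> [Phi [PhiI lifts]]; apply: (lift_dominant iota_incl au (Phi := Phi)).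
  by move=> phi /PhiI[[st _] v].
by move=> Sigma lift pure; apply: lifts; split=> //; apply: pure => phi /PhiI[].
Qed.
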